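(* Let $n,k$ be integers with $3\le k\le n$ and $k\neq 5$. There exists an integer $\mathrm{H}_k(n;k)$ if and only if one of the following holds: (i) $k$ is odd and $n\equiv 0,3\pmod 4$; (ii) $k\equiv 2\pmod 4$ and $n$ is even; (iii) $k\equiv 0\pmod 4$. Furthermore, for integers $n\geq 5$: there exists an integer $\mathrm{H}_5(n;5)$ if $n\equiv 3\pmod 4$, and there does not exist an integer $\mathrm{H}_5(n;5)$ if $n\equiv 1,2\pmod 4$.
   Context: A partially filled (p.f.) $m\times n$ array is an $m\times n$ matrix in which some cells are allowed to be empty. Let $n,k,t$ be positive integers such that $t$ divides $2nk$, let $v=2nk+t$, and let $J$ be the subgroup of $\mathbb{Z}_v$ of order $t$. An $\mathrm{H}_t(n;k)$ (square Heffter array over $\mathbb{Z}_v$ relative to $J$) is an $n\times n$ p.f. array with elements in $\mathbb{Z}_v$ such that: each row and each column contains exactly $k$ filled cells; for every $x\in\mathbb{Z}_v\setminus J$, either $x$ or $-x$ appears in the array; the elements in every row and every column sum to $0$ in $\mathbb{Z}_v$. It is called integer if the elements in every row and every column, viewed as integers in $\pm\{1,\ldots,\lfloor\frac{2nk+t}{2}\rfloor\}$, sum to zero in $\mathbb{Z}$. Here $t=k$, so $v=k(2n+1)$ and $J$ is the subgroup of multiples of $2n+1$. *)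

(* Defs.v *)
From mathcomp Require Import all_boot all_order all_algebra all_fingroup.
From mathcomp Require Import all_solvable.

Set Implicit Arguments.
Unset Strict Implicit.
Unset Printing Implicit Defensive.

Import GRing.Theory.

Local Open Scope ring_scope.

(* [None] is an empty cell. *)
Definition pf_array (T : Type) (m n : nat) := 'M[option T]_(m, n).

Definition heffter_modulus (n k t : nat) : nat := (2 * n * k + t)%N.

Lemma heffter_modulus_gt1 (n k t : nat) :
  (0 < n)%N -> (0 < k)%N -> (1 < heffter_modulus n k t)%N.
Proof.
move=> n0 k0; rewrite /heffter_modulus -mulnA; apply: leq_trans (leq_addr _ _).
by rewrite leq_pmulr // muln_gt0 n0.
Qed.

(* The group law on 'Z_v is addition, so this is the set of multiples of
   v / t. *)
Definition heffter_subgroup (n k t : nat) :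
    {group 'Z_(heffter_modulus n k t)} :=
  <[((heffter_modulus n k t %/ t)%N)%:R : 'Z_(heffter_modulus n k t)]>%G.

Lemma card_heffter_subgroup (n k t : nat) :
  (0 < n)%N -> (0 < k)%N -> (0 < t)%N -> (t %| 2 * n * k)%N ->
  #|heffter_subgroup n k t| = t.
Proof.
move=> n0 k0 t0 dvd_t; have dvd_tv : (t %| heffter_modulus n k t)%N.
  by rewrite dvdn_addl.
have v1 := heffter_modulus_gt1 t n0 k0.
set v := heffter_modulus n k t in dvd_tv v1 *.
have o1 : #[Zp1 : 'Z_v]%g = v by rewrite order_Zp1 Zp_cast.
have -> : #|heffter_subgroup n k t| = #[(Zp1 : 'Z_v) ^+ (v %/ t)%N]%g.
  by [].
rewrite orderXdiv o1; first by rewrite divnA // mulKn // ltnW.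
exact: dvdn_div.
Qed.

(* The representative of x in [-(p-1)/2, p/2]; for x <> 0 it lies in
   +-{1, ..., floor(p/2)}. Only the residue p/2 with p even has two
   representatives there; it belongs to the subgroup J, hence never occurs in a
   relative Heffter array. *)
Definition Zp_signed (p : nat) (x : 'Z_p) : int :=
  if (x <= p./2)%N then (x : nat)%:Z else (x : nat)%:Z - p%:Z.

(* The array has n * k filled cells, and the complement of J consists of n * k
   pairs {x, -x} with x <> -x. Hence the second clause forces each such pair to
   be represented exactly once, and no element of J to occur. *)
Definition is_Heffter (n k t : nat)
    (A : pf_array 'Z_(heffter_modulus n k t) n n) : Prop :=
  [/\ (forall i, #|[set j | A i j != None]| = k) /\
      (forall j, #|[set i | A i j != None]| = k),
      forall x : 'Z_(heffter_modulus n k t), x \notin heffter_subgroup n k t ->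
        exists i j, A i j = Some x \/ A i j = Some (- x),
      forall i, \sum_j odflt 0 (A i j) = 0
    & forall j, \sum_i odflt 0 (A i j) = 0].

Definition is_integer_Heffter (n k t : nat)
    (A : pf_array 'Z_(heffter_modulus n k t) n n) : Prop :=
  [/\ is_Heffter A,
      forall i, \sum_j oapp (@Zp_signed (heffter_modulus n k t)) 0 (A i j) = 0
    & forall j, \sum_i oapp (@Zp_signed (heffter_modulus n k t)) 0 (A i j) = 0].

Definition exists_integer_Heffter (n k t : nat) : Prop :=
  exists A : pf_array 'Z_(heffter_modulus n k t) n n,
    is_integer_Heffter A.

(* Main.v *)
(* Write N = 2n+1. The numbers to be placed form k "chunks" of n consecutive
   integers, and the parity of their sum gives the necessary conditions.

   The array is a union of k layers, one entry per row and per column each, the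
   layers being mostly cyclic diagonals. Four further diagonals can always be
   filled with the next four chunks, so only few values of k matter.

   For odd k, write the entries as c N + f with |f| <= n. Giving the symmetric
   cells (i, i+d) and (i+d, i) the entries f i + c N and f i - c N, the multiples
   of N cancel, row i and column i have the same sum, and only a row condition on
   small labels is left. For k = 3 it asks for a signed permutation f of 1, ..., n
   on Z_n whose sums of cyclic neighbours are again a signed permutation; three
   copies with coefficients (0,4,-4), (1,2,-3), (-1,-2,3) solve k = 9. For k = 5
   there are two sequences, on the edges {i, i+1} and {i, i+2}.

   For k = 2 mod 4 and n even, the array is cut into 2 x 2 blocks
     a, -(a-r), -(a-c), a-r-c,
   whose row sums r, -r and column sums c, -c do not involve a: it suffices that
   the r's of a block row and the c's of a block column cancel. *)

Require Import Defs.
From mathcomp Require Import all_boot all_order all_algebra all_fingroup.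
From mathcomp Require Import zify ring.

Set Implicit Arguments.
Unset Strict Implicit.
Unset Printing Implicit Defensive.

Import GRing.Theory Num.Theory.

(** * Arrays from layers *)

Section SignedRepresentatives.
Local Open Scope ring_scope.

Lemma nat_Zp (p x : nat) : (1 < p)%N -> ((x%:R : 'Z_p) : nat) = (x %% p)%N.
Proof. by move=> p1; rewrite val_Zp_nat. Qed.

Lemma modulus_Zp (p : nat) : (1 < p)%N -> (p%:R : 'Z_p) = 0.
Proof. by move=> p1; apply: val_inj; rewrite /= nat_Zp // modnn. Qed.

Lemma Zp_signed_intr (p : nat) (z : int) :
  (1 < p)%N -> (2 * `|z| < p)%N -> Zp_signed (z%:~R : 'Z_p) = z.
Proof.
move=> p1; case: z => m /= hm; rewrite /Zp_signed.
  by rewrite -pmulrn nat_Zp // modn_small ?ifT //; lia.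
rewrite NegzE mulrNz -pmulrn.
have -> : (- (m.+1%:R) : 'Z_p) = ((p - m.+1)%N)%:R.
  rewrite natrB; last by lia.
  by rewrite modulus_Zp // sub0r.
rewrite nat_Zp // modn_small; last by lia.
by rewrite ifF; lia.
Qed.

Lemma intr_Zp_signed (p : nat) (x : 'Z_p) : (1 < p)%N -> (Zp_signed x)%:~R = x.
Proof.
move=> p1; rewrite /Zp_signed; case: ifP => _.
  by rewrite -pmulrn natr_Zp.
by rewrite mulrzBr -!pmulrn natr_Zp modulus_Zp // subr0.
Qed.

Lemma Zp_signed_bound (p : nat) (x : 'Z_p) :
  (1 < p)%N -> (2 * `|Zp_signed x| <= p)%N.
Proof.
move=> p1; have := ltn_ord x; rewrite [X in (_ < X)%N -> _](Zp_cast p1).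
by rewrite /Zp_signed; case: ifP => /=; lia.
Qed.

End SignedRepresentatives.

Lemma heffter_modulusE (n k : nat) : heffter_modulus n k k = k * (2 * n + 1).
Proof. by rewrite /heffter_modulus; nia. Qed.

Lemma heffter_subgroupE (n k : nat) :
  0 < k -> heffter_subgroup n k k =
  <[((2 * n + 1)%:R)%R : 'Z_(heffter_modulus n k k)]>%G.
Proof.
move=> k0; rewrite /heffter_subgroup.
by rewrite [in X in (X%:R)%R](heffter_modulusE n k) mulKn.
Qed.

Lemma mem_heffter_subgroup (n k m : nat) :
  0 < n -> 0 < k -> 
  ((m%:R)%R \in heffter_subgroup n k k) = (2 * n + 1 %| m).
Proof.
move=> n0 k0; have p1 := heffter_modulus_gt1 k n0 k0.
have dNp : 2 * n + 1 %| heffter_modulus n k k.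
  by rewrite heffter_modulusE dvdn_mull.
rewrite heffter_subgroupE //; apply/cycleP/idP => [[i]|/dvdnP[c ->]].
  rewrite FinRing.zmodXgE -mulrnA.
  move=> /(congr1 (fun x : 'Z_(heffter_modulus n k k) => x : nat)).
  rewrite !nat_Zp // => e; rewrite /dvdn -(modn_dvdm m dNp) e modn_dvdm //.
  by rewrite mulnC modnMl.
by exists c; rewrite FinRing.zmodXgE -mulrnA mulnC.
Qed.

Section Assembly.
Local Open Scope ring_scope.

(** The strict bound makes [Zp_signed] return each entry [v t i] itself, so vanishing integer sums
    yield the modular and the integer clauses alike. Covering concerns absolute values only, since
    [x] and [-x] are interchangeable. *)
Lemma Heffter_of_layers (n k : nat) (v : nat -> nat -> int)
    (col row : nat -> nat -> nat) :
  (0 < n)%N -> (0 < k)%N ->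
  (forall t i, (t < k)%N -> (i < n)%N -> (col t i < n)%N /\ row t (col t i) = i) ->
  (forall t j, (t < k)%N -> (j < n)%N -> (row t j < n)%N /\ col t (row t j) = j) ->
  (forall t t' i, (t < k)%N -> (t' < k)%N -> (i < n)%N ->
     col t i = col t' i -> t = t') ->
  (forall i, (i < n)%N -> \sum_(t < k) v t i = 0) ->
  (forall j, (j < n)%N -> \sum_(t < k) v t (row t j) = 0) ->
  (forall t i, (t < k)%N -> (i < n)%N -> (2 * `|v t i| < k * (2 * n + 1))%N) ->
  (forall x, (0 < x)%N -> (2 * x <= k * (2 * n + 1))%N -> ~~ (2 * n + 1 %| x)%N ->
     exists t i, [/\ (t < k)%N, (i < n)%N & `|v t i|%N = x]) ->
  exists_integer_Heffter n k k.
Proof.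
move=> n0 k0 colP rowP col_inj rowsum colsum bound cover.
have p1 := heffter_modulus_gt1 k n0 k0.
pose A : pf_array 'Z_(heffter_modulus n k k) n n :=
  \matrix_(i, j) omap (fun t : 'I_k => (v t i)%:~R) [pick t : 'I_k | col t i == j].
have AS (i j : 'I_n) (t : 'I_k) : col t i = j -> A i j = Some ((v t i)%:~R).
  move=> e; rewrite mxE; case: pickP => [t' /eqP e'|/(_ t)]; last by rewrite e eqxx.
  by congr (Some (v _ _)%:~R); apply: (col_inj t' t i); rewrite ?e'.
have AN (i j : 'I_n) : (forall t : 'I_k, col t i != j) -> A i j = None.
  by move=> ne; rewrite mxE; case: pickP => // t; rewrite (negPf (ne t)).
pose colo (t : 'I_k) (i : 'I_n) : 'I_n := Ordinal (proj1 (colP t i (ltn_ord t) (ltn_ord i))).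
pose rowo (t : 'I_k) (j : 'I_n) : 'I_n := Ordinal (proj1 (rowP t j (ltn_ord t) (ltn_ord j))).
have coloK t : cancel (colo t) (rowo t).
  by move=> i; apply: val_inj; case: (colP t i (ltn_ord t) (ltn_ord i)).
have rowoK t : cancel (rowo t) (colo t).
  by move=> i; apply: val_inj; case: (rowP t i (ltn_ord t) (ltn_ord i)).
have colo_inj i : injective (colo^~ i).
  move=> t t' /(congr1 val) /= e; apply: val_inj.
  exact: (col_inj t t' i).
have rowo_inj j : injective (rowo^~ j).
  move=> t t' e; apply: (colo_inj (rowo t j)); rewrite rowoK.
  by rewrite e rowoK.
have ASo i t : A i (colo t i) = Some ((v t i)%:~R) by apply: AS.
have Arow i : [set j | A i j != None] = [set colo t i | t : 'I_k].
  apply/setP => j; rewrite inE; apply/idP/imsetP => [|[t _ ->]]; last by rewrite ASo.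
  have [/existsP[t /eqP e] _|/existsPn ne] := boolP [exists t : 'I_k, colo t i == j].
    by exists t.
  by rewrite AN // => t; apply: contraNN (ne t) => /eqP e; apply/eqP/val_inj.
have Acol j : [set i | A i j != None] = [set rowo t j | t : 'I_k].
  apply/setP => i; rewrite inE; apply/idP/imsetP => [|[t _ ->]].
    have [/existsP[t /eqP e] _|/existsPn ne] := boolP [exists t : 'I_k, colo t i == j].
      by exists t => //; rewrite -e coloK.
    by rewrite AN // => t; apply: contraNN (ne t) => /eqP e; apply/eqP/val_inj.
  by rewrite -{2}(rowoK t j) ASo.
(* An arbitrary [F] makes sums of residues and sums of signed representatives two instances of one
   identity. *)
have Asumr (S : nmodType) (F : option 'Z_(heffter_modulus n k k) -> S) i :
    F None = 0 -> \sum_j F (A i j) = \sum_(t < k) F (Some ((v t i)%:~R)).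
  move=> F0; rewrite (bigID [in [set j | A i j != None]]) /= addrC big1 ?add0r.
    rewrite Arow big_imset /=; last by move=> t t' _ _ /colo_inj.
    by apply: eq_bigr => t _; rewrite ASo.
  by move=> j; rewrite inE negbK => /eqP ->.
have Asumc (S : nmodType) (F : option 'Z_(heffter_modulus n k k) -> S) j :
    F None = 0 -> \sum_i F (A i j) = \sum_(t < k) F (Some ((v t (row t j))%:~R)).
  move=> F0; rewrite (bigID [in [set i | A i j != None]]) /= addrC big1 ?add0r.
    rewrite Acol big_imset /=; last by move=> t t' _ _ /rowo_inj.
    by apply: eq_bigr => t _; rewrite -{2}(rowoK t j) ASo.
  by move=> i; rewrite inE negbK => /eqP ->.
have sgnv t i : (t < k)%N -> (i < n)%N ->
    Zp_signed ((v t i)%:~R : 'Z_(heffter_modulus n k k)) = v t i.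
  by move=> tk ik; rewrite Zp_signed_intr // heffter_modulusE bound.
exists A; split; first split.
- by split=> [i|j]; rewrite ?Arow ?Acol card_imset ?card_ord.
- move=> x xJ; pose y := `|Zp_signed x|%N.
  have yx : x = y%:R \/ x = - y%:R.
    rewrite -[x in x = _]intr_Zp_signed // -[x in _ \/ x = _]intr_Zp_signed //.
    by rewrite /y !pmulrn; case: (Zp_signed x) => m; [left|right; rewrite NegzE rmorphN].
  have yJ : ~~ (2 * n + 1 %| y)%N.
    rewrite -(mem_heffter_subgroup _ n0 k0); apply: contraNN xJ.
    by case: yx => -> //; rewrite -FinRing.zmodVgE groupV.
  have y0 : (0 < y)%N by case: (y) yJ => //; rewrite dvdn0.
  have yp : (2 * y <= k * (2 * n + 1))%N by rewrite -heffter_modulusE Zp_signed_bound.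
  have [t [i [tk ik vy]]] := cover y y0 yp yJ.
  exists (Ordinal ik), (colo (Ordinal tk) (Ordinal ik)); rewrite ASo /=.
  have : v t i = y%:Z \/ v t i = - y%:Z by lia.
  case=> ->; rewrite ?rmorphN /= -pmulrn; case: yx => ->; rewrite ?opprK; tauto.
- move=> i; rewrite (Asumr _ (odflt 0)) //= -(rmorph_sum intr) /= rowsum //.
- move=> j; rewrite (Asumc _ (odflt 0)) //= -(rmorph_sum intr) /= colsum //.
- move=> i; rewrite (Asumr _ (oapp (@Zp_signed _) 0)) //= -[RHS](rowsum i) //.
  by apply: eq_bigr => t _; rewrite sgnv.
- move=> j; rewrite (Asumc _ (oapp (@Zp_signed _) 0)) //= -[RHS](colsum j) //.
  by apply: eq_bigr => t _; rewrite sgnv //; case: (rowP t j).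
Qed.

End Assembly.

(** * Necessity *)

(** Chunk [q] consists of [chunk n q + m] for [0 < m <= n]; two chunks fill the gap between
    successive multiples of [2 * n + 1]. *)
Definition chunk (n q : nat) : nat := q./2 * (2 * n + 1) + odd q * n.

Lemma chunkSS (n q : nat) : chunk n q.+2 = chunk n q + (2 * n + 1).
Proof. by rewrite /chunk /= negbK; lia. Qed.

Lemma chunk_pair (n a : nat) :
  chunk n (2 * a) = a * (2 * n + 1) /\ chunk n (2 * a).+1 = a * (2 * n + 1) + n.
Proof. by rewrite /chunk mul2n /= odd_double doubleK uphalf_double; lia. Qed.

Lemma chunk_ndvd (n q m : nat) : 0 < m <= n -> ~~ (2 * n + 1 %| chunk n q + m).
Proof.
move=> hm; rewrite /chunk -(addnA _ _ m) /dvdn modnMDl.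
by case: (odd q); rewrite ?mul1n modn_small; lia.
Qed.

Lemma chunk_inj (n q q' m m' : nat) : 0 < m <= n -> 0 < m' <= n ->
  chunk n q + m = chunk n q' + m' -> q = q' /\ m = m'.
Proof.
move=> hm hm'; rewrite /chunk -(addnA _ _ m) -(addnA _ _ m') => e.
have e1 : q./2 = q'./2.
  have N0 : 0 < 2 * n + 1 by rewrite addn1.
  have := congr1 (fun x => x %/ (2 * n + 1)) e; rewrite /= !(divnMDl _ _ N0).
  by rewrite !divn_small //; case: (odd q); case: (odd q'); rewrite ?mul1n; lia.
move: (odd_double_half q) (odd_double_half q') e; rewrite e1.
by case: (odd q); case: (odd q'); rewrite ?mul1n ?mul0n; lia.
Qed.

Lemma chunk_le (n k q m : nat) : q < k -> m <= n ->
  2 * (chunk n q + m) < k * (2 * n + 1).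
Proof. by rewrite /chunk => qk mn; move: (odd_double_half q); case: (odd q); rewrite ?mul1n; nia. Qed.

Lemma chunkP (n k x : nat) : 0 < x -> 2 * x <= k * (2 * n + 1) ->
  ~~ (2 * n + 1 %| x) -> exists q m, [/\ q < k, 0 < m <= n & x = chunk n q + m].
Proof.
move=> x0 xk; rewrite /dvdn => xN.
have r2 : x %% (2 * n + 1) < 2 * n + 1 by rewrite ltn_mod addn1.
have xE := divn_eq x (2 * n + 1).
move: xE r2 xN; move: (x %/ _) (x %% _) => c r xE r2 xN.
have [e1 e2] := chunk_pair n c.
case: (leqP r n) => rn; [exists (2 * c), r|exists (2 * c).+1, (r - n)].
  split; [nia | lia | by rewrite e1].
by split; [nia | lia | rewrite e2 -(addnA _ n) (subnKC (ltnW rn))].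
Qed.

Definition support_seq (n k : nat) : seq nat :=
  [seq chunk n q + m | q <- iota 0 k, m <- iota 1 n].

Lemma support_seq_uniq (n k : nat) : uniq (support_seq n k).
Proof.
apply: allpairs_uniq; rewrite ?iota_uniq // => [[q m] [q' m']].
move=> /allpairsP[[a b] [_ + [-> ->]]] /allpairsP[[a' b'] [_ + [-> ->]]] /=.
rewrite !mem_iota /= !ltnS => hb hb' e.
by have [-> ->] := chunk_inj hb hb' e.
Qed.

Lemma support_sum (n k : nat) :
  \sum_(x <- support_seq n k) x = \sum_(q < k) (n * chunk n q + 'C(n.+1, 2)).
Proof.
have iotaE a b : iota a b = index_iota a (a + b) by rewrite /index_iota addKn.
rewrite big_allpairs_dep !iotaE add0n big_mkord.
apply: eq_bigr => q _; rewrite big_split /= sum_nat_const_nat addKn.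
by rewrite -triangular_sum [in RHS]big_nat_recl // add0n add1n big_add1.
Qed.

(** Modulo 2, the triangular numbers of two successive chunks cancel, and [n] times their offsets
    adds [n] if [k] is even and 0 if [k] is odd; hence the induction in steps of two. *)
Lemma odd_support_sum (n k : nat) :
  odd (\sum_(x <- support_seq n k) x) =
  if odd k then odd 'C(n.+1, 2) else odd n && odd k./2.
Proof.
rewrite support_sum; move: 'C(n.+1, 2) => T; elim/ltn_ind: k => -[|[|k]] IH; first by rewrite big_ord0 andbF.
  by rewrite big_ord1 /chunk /= mul0n muln0.
rewrite !big_ord_recr /= -!addnA !oddD IH // negbK.
have [c0 c1] : odd (chunk n k) = odd k./2 (+) odd k && odd n /\
    odd (chunk n k.+1) = odd (uphalf k) (+) ~~ odd k && odd n.
  by rewrite /chunk !(oddD, oddM) /= !andbT; case: (odd k).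
rewrite !oddM c0 c1 uphalf_half oddD oddb.
by case: (odd k); case: (odd n); case: (odd k./2); case: (odd T).
Qed.

Lemma odd_absz_sum (I : Type) (r : seq I) (P : pred I) (F : I -> int) :
  odd `|(\sum_(i <- r | P i) F i)%R| = odd (\sum_(i <- r | P i) `|F i|).
Proof.
elim/big_rec2: _ => // i x y _; rewrite oddD => e.
have odd_abszD (a b : int) : odd `|(a + b)%R| = odd `|a| (+) odd `|b| by lia.
by rewrite odd_abszD; congr (_ (+) _).
Qed.

(** All [n * k] numbers of the support occur among the absolute values of the [n * k] filled cells,
    so these values permute the support. Signs do not affect parity, and the signed total is 0. *)
Lemma integer_Heffter_even_sum (n k : nat) : 0 < n -> 0 < k ->
  exists_integer_Heffter n k k -> ~~ odd (\sum_(x <- support_seq n k) x).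
Proof.
move=> n0 k0 [A [[[rowk colk] cover _ _] rowsum _]].
have p1 := heffter_modulus_gt1 k n0 k0.
pose F := [pred c : 'I_n * 'I_n | A c.1 c.2 != None].
pose s (c : 'I_n * 'I_n) := oapp (@Zp_signed _) 0%R (A c.1 c.2).
have sizeF : size [seq `|s c| | c <- enum F] = n * k.
  rewrite size_map -cardE -sum1_card.
  rewrite (eq_bigl (fun c => true && (A c.1 c.2 != None))) //.
  rewrite -(pair_big_dep xpredT (fun i j => A i j != None) (fun _ _ => 1)) /=.
  under eq_bigr => i _.
    have -> : \sum_(j | A i j != None) 1 = #|[set j | A i j != None]|.
      by rewrite -sum1_card; apply: eq_bigl => j; rewrite inE.
    rewrite rowk; over.
  by rewrite sum_nat_const card_ord.
have sub : {subset support_seq n k <= [seq `|s c| | c <- enum F]}.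
  move=> x /allpairsP[[q m] [/= + + ->]]; rewrite !mem_iota => hq hm.
  have hx := chunk_le (ltac:(lia) : q < k) (ltac:(lia) : m <= n).
  have := chunk_ndvd q (ltac:(lia) : 0 < m <= n).
  rewrite -(mem_heffter_subgroup _ n0 k0) => /cover[i [j Aij]].
  apply/mapP; exists (i, j).
    by rewrite mem_enum inE /=; case: Aij => ->.
  rewrite -heffter_modulusE in hx.
  have e (z : int) : `|z| = chunk n q + m -> Zp_signed (z%:~R : 'Z_(heffter_modulus n k k))%R = z.
    by move=> hz; rewrite Zp_signed_intr // hz.
  rewrite /s /=; case: Aij => ->; rewrite /= pmulrn -?mulrNz e ?abszN //.
have usz : size [seq `|s c| | c <- enum F] <= size (support_seq n k).
  by rewrite sizeF size_allpairs !size_iota mulnC.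
have [_ eqi] := uniq_min_size (support_seq_uniq n k) sub usz.
have u2 := leq_size_uniq (support_seq_uniq n k) sub usz.
rewrite (perm_big _ (uniq_perm (support_seq_uniq n k) u2 eqi)) big_map.
rewrite -odd_absz_sum big_enum /=.
rewrite [X in `|X|](_ : _ = 0%R) //.
rewrite (eq_bigl (fun c => true && (A c.1 c.2 != None))) //.
rewrite -(pair_big_dep xpredT (fun i j => A i j != None) (fun i j => s (i, j))) /=.
rewrite big1 // => i _; rewrite -[RHS](rowsum i) big_mkcond /=.
by apply: eq_bigr => j _; rewrite /s /=; case: (A i j).
Qed.

(** * Cyclic diagonals *)

Section CyclicLayers.
Local Open Scope ring_scope.

Definition prev (n i : nat) : nat := ((i + n.-1) %% n)%N.

(** Layer [t] fills the cells (i, i+t) modulo [n], so column [j] meets it in row j-t: one step of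
    [prev] per layer. *)
Fixpoint colsum (n : nat) (s : seq (nat -> int)) (j : nat) : int :=
  if s is h :: s' then h j + colsum n s' (prev n j) else 0.

Definition rowsum (s : seq (nat -> int)) (i : nat) : int := \sum_(h <- s) h i.

Definition layer (s : seq (nat -> int)) (t : nat) : nat -> int :=
  nth (fun=> 0) s t.

(** Covering is phrased by chunks, so that appended layers only have to supply the new chunks. *)
Record good_layers (n : nat) (s : seq (nat -> int)) : Prop := GoodLayers {
  good_rowsum : forall i, (i < n)%N -> rowsum s i = 0;
  good_colsum : forall j, (j < n)%N -> colsum n s j = 0;
  good_cover : forall q m, (q < size s)%N -> (0 < m <= n)%N ->
    exists t i, [/\ (t < size s)%N, (i < n)%N & `|layer s t i|%N = (chunk n q + m)%N];
  good_bound : forall t i, (t < size s)%N -> (i < n)%N ->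
    (2 * `|layer s t i| < size s * (2 * n + 1))%N
}.

Lemma prev_lt (n i : nat) : (i < n)%N -> (prev n i < n)%N.
Proof. by move=> h; rewrite ltn_mod; lia. Qed.

Lemma prevE (n i : nat) : (i < n)%N -> prev n i = if i is i'.+1 then i' else n.-1.
Proof.
case: i => [|i] h; rewrite /prev; first by rewrite modn_small; lia.
by rewrite addSnnS prednK ?modnDr ?modn_small; lia.
Qed.

Lemma prev_onto (n i : nat) : (i < n)%N -> exists2 i', (i' < n)%N & prev n i' = i.
Proof.
move=> h; have [e|ne] := eqVneq i.+1 n.
  by exists 0%N; [lia | rewrite prevE; lia].
by exists i.+1; [lia | rewrite prevE; lia].
Qed.

Lemma prev_onto_of (n : nat) (f : nat -> int) (i : nat) :
  (i < n)%N -> exists2 i', (i' < n)%N & f (prev n i') = f i.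
Proof. by case/prev_onto=> i' ik <-; exists i'. Qed.

Lemma prev2_onto_of (n : nat) (f : nat -> int) (i : nat) :
  (i < n)%N -> exists2 i', (i' < n)%N & f (prev n (prev n i')) = f i.
Proof. by case/prev_onto=> i' /prev_onto[i'' ik <-] <-; exists i''. Qed.

Lemma iter_prev (n t j : nat) : (j < n)%N ->
  iter t (prev n) j = ((j + t * n.-1) %% n)%N.
Proof.
move=> h; elim: t => [|t IH]; first by rewrite addn0 modn_small.
by rewrite iterS IH /prev modnDml -addnA [(t * _ + _)%N]addnC -mulSn.
Qed.

Lemma colsumE (n : nat) (s : seq (nat -> int)) (j : nat) :
  colsum n s j = \sum_(t < size s) layer s t (iter t (prev n) j).
Proof.
elim: s j => [|h s IH] j; first by rewrite big_ord0.
by rewrite /= IH big_ord_recl; congr (_ + _); apply: eq_bigr => t _; rewrite -iterSr.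
Qed.

Lemma colsum_cat (n : nat) (s1 s2 : seq (nat -> int)) (j : nat) :
  colsum n (s1 ++ s2) j = colsum n s1 j + colsum n s2 (iter (size s1) (prev n) j).
Proof.
elim: s1 j => [|h s IH] j; first by rewrite add0r.
by rewrite /= IH addrA -iterSr.
Qed.

(** At most [n] cyclic diagonals are disjoint; adding [t * n.-1] subtracts [t] modulo [n]. *)
Lemma Heffter_of_good_layers (n : nat) (s : seq (nat -> int)) :
  (0 < size s <= n)%N -> good_layers n s -> exists_integer_Heffter n (size s) (size s).
Proof.
move=> /andP[k0 kn] [rs cs cov bnd]; have n0 : (0 < n)%N by lia.
have tn t : ((t + t * n.-1) = t * n)%N by rewrite -mulnS prednK.
apply: (@Heffter_of_layers n _ (layer s) (fun t i => (i + t) %% n)%N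
          (fun t j => (j + t * n.-1) %% n)%N) => //.
- move=> t i _ ik; split; first by rewrite ltn_mod.
  by rewrite modnDml -addnA tn addnC modnMDl modn_small.
- move=> t i _ ik; split; first by rewrite ltn_mod.
  by rewrite modnDml -addnA [(t * _ + t)%N]addnC tn addnC modnMDl modn_small.
- move=> t t' i tk tk' ik /eqP; rewrite eqn_modDl !modn_small; [|lia|lia].
  by move/eqP.
- by move=> i ik; rewrite -[RHS](rs i ik) /rowsum (big_nth (fun=> 0)) big_mkord.
- move=> j jk; rewrite -[RHS](cs j jk) colsumE.
  by apply: eq_bigr => t _; rewrite iter_prev.
- by move=> x x0 xk xN; have [q [m [qk hm ->]]] := chunkP x0 xk xN; apply: cov.
Qed.

(* Reading the third and fourth layers at [i] and the first two at [i - 2] makes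
   all four cells of a column depend on only two consecutive indices. *)
Definition quad (n q : nat) : seq (nat -> int) :=
  [:: (fun i => - (chunk n q + prev n (prev n i)).+1%:Z);
      (fun i => (chunk n q.+1 + prev n (prev n i)).+1%:Z);
      (fun i => (chunk n q.+2 + i).+1%:Z);
      (fun i => - (chunk n q.+3 + i).+1%:Z)].

(** The offsets of the four chunks satisfy c2-c0 = c3-c1. In a row the indices cancel between layers
    1 and 2 and between 3 and 4; in a column between 1 and 3 and between 2 and 4. This holds at
    every index, so the shift caused by the earlier layers is harmless. *)
Lemma good_cat_quad (n : nat) (s : seq (nat -> int)) :
  (0 < n)%N -> good_layers n s -> good_layers n (s ++ quad n (size s)).
Proof.
move=> n0 [rs cs cov bnd]; set k := size s.
have c2 := chunkSS n k; have c3 := chunkSS n k.+1.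
have layerl t : (t < k)%N -> layer (s ++ quad n k) t = layer s t.
  by move=> h; rewrite /layer nth_cat h.
have layerr t : layer (s ++ quad n k) (k + t)%N = layer (quad n k) t.
  by rewrite /layer nth_cat -/k ltnNge leq_addr /= addKn.
have itp j : (j < n)%N -> (iter k (prev n) j < n)%N.
  by move=> h; rewrite iter_prev // ltn_mod.
split.
- move=> i ik; rewrite /rowsum big_cat /= -/(rowsum s i) rs // add0r.
  by rewrite !big_cons big_nil c2 c3; lia.
- move=> j jk; rewrite colsum_cat cs // add0r /= -/k.
  by move: (iter _ _ j) => a; rewrite c2 c3; lia.
- move=> q m; rewrite size_cat /= => qk hm.
  have [ql|qr] := ltnP q k.
    have [t [i [tk ik e]]] := cov q m ql hm; exists t, i.
    by rewrite layerl //; split=> //; lia.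
  have [i1 i1n e1] := prev_onto (ltac:(lia) : (m.-1 < n)%N).
  have [i2 i2n e2] := prev_onto i1n.
  have : exists t, (q = k + t)%N /\ (t < 4)%N by exists (q - k)%N; lia.
  case=> -[|[|[|[|t]]]] [-> //] _; rewrite ?addn0 ?addn1 ?addn2 ?addn3.
  + by exists k, i2; rewrite -[k in layer _ k]addn0 layerr /= e2 e1; split; lia.
  + by exists (k + 1)%N, i2; rewrite layerr /= e2 e1; split; lia.
  + by exists (k + 2)%N, m.-1; rewrite layerr /=; split; lia.
  + by exists (k + 3)%N, m.-1; rewrite layerr /=; split; lia.
- move=> t i; rewrite size_cat /= => tk ik.
  have [tl|tr] := ltnP t k.
    by rewrite layerl // mulnDl; have := bnd t i tl ik; lia.
  have p1 := prev_lt (prev_lt ik).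
  have : exists t', (t = k + t')%N /\ (t' < 4)%N by exists (t - k)%N; lia.
  case=> t' [-> t4]; rewrite layerr.
  have : exists q x, [/\ (q < k + 4)%N, (x <= n)%N & `|layer (quad n k) t' i|%N = (chunk n q + x)%N].
    move: t4; case: t' {tr tk t} => [|[|[|[|//]]]] _.
    + by exists k, (prev n (prev n i)).+1; split; rewrite //=; lia.
    + by exists k.+1, (prev n (prev n i)).+1; split; rewrite //=; lia.
    + by exists k.+2, i.+1; split; rewrite //=; lia.
    + by exists k.+3, i.+1; split; rewrite //=; lia.
  by case=> q [x [qk xn ->]]; apply: chunk_le.
Qed.

Lemma good_extend (n : nat) (s : seq (nat -> int)) (d : nat) :
  (0 < n)%N -> good_layers n s ->
  exists2 s', good_layers n s' & size s' = (size s + 4 * d)%N.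
Proof.
move=> n0 gs; elim: d => [|d [s' gs' e]]; first by exists s; rewrite ?addn0.
by exists (s' ++ quad n (size s')); [apply: good_cat_quad | rewrite size_cat /= e; lia].
Qed.

Lemma good_nil (n : nat) : good_layers n [::].
Proof. by split=> // i _; rewrite /rowsum big_nil. Qed.

Lemma Heffter_mod4 (n k : nat) (s : seq (nat -> int)) :
  (0 < k <= n)%N -> good_layers n s -> (size s <= k)%N ->
  k = size s %[mod 4] -> exists_integer_Heffter n k k.
Proof.
move=> kn gs sk ek.
have [s' gs' e] := good_extend ((k - size s) %/ 4) (ltac:(lia) : (0 < n)%N) gs.
have <- : size s' = k by rewrite e; lia.
by apply: Heffter_of_good_layers => //; lia.
Qed.

(** * Signed permutations and pairs of layers with opposite offsets *)

Definition signed_perm (n : nat) (f : nat -> int) : Prop :=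
  (forall i, (i < n)%N -> (`|f i| <= n)%N) /\
  (forall m, (0 < m <= n)%N -> exists2 i, (i < n)%N & `|f i|%N = m).

Lemma signed_perm_prev (n : nat) (f : nat -> int) :
  signed_perm n f -> signed_perm n (fun i => f (prev n i)).
Proof.
move=> [b c]; split=> [i ik|m hm]; first exact/b/prev_lt.
by have [i ik <-] := c m hm; have [i' ik' e] := prev_onto ik; exists i'; rewrite ?e.
Qed.

Lemma signed_permN (n : nat) (f : nat -> int) :
  signed_perm n f -> signed_perm n (fun i => - f i).
Proof.
move=> [b c]; split=> [i ik|m hm]; first by rewrite abszN b.
by have [i ik <-] := c m hm; exists i; rewrite ?abszN.
Qed.

(** With N = 2n+1 and x = |f i|, adding and subtracting cN gives the absolute values cN+x and cN-x
    in an order set by the sign of [f i]. These run through chunks 2c and 2c-1. As [g] rearranges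
    [f], the second layer may be read at shifted indices. *)
Lemma offset_cover (n c q m : nat) (f g : nat -> int) :
  (forall i, (i < n)%N -> exists2 i', (i' < n)%N & g i' = f i) ->
  signed_perm n f -> (0 < c)%N -> q = (2 * c)%N \/ q.+1 = (2 * c)%N ->
  (0 < m <= n)%N ->
  exists2 i, (i < n)%N & `|(f i + c%:Z * (2 * n + 1)%:Z)%R|%N = (chunk n q + m)%N \/
                         `|(g i - c%:Z * (2 * n + 1)%:Z)%R|%N = (chunk n q + m)%N.
Proof.
move=> fg [_ cov] c0 hq hm; have [e1 e2] := chunk_pair n c.
have [e3 e4] := chunk_pair n c.-1.
have ec : (chunk n q + m = c * (2 * n + 1) + m \/
           chunk n q + m + (n.+1 - m) = c * (2 * n + 1))%N.
  case: hq => hq; [left; rewrite hq e1 // | right].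
  have -> : q = (2 * c.-1).+1 by lia.
  by rewrite e4 -{2}(prednK c0) mulSn; lia.
have bc : (2 * n + 1 <= c * (2 * n + 1))%N by rewrite leq_pmull.
rewrite -PoszM; move: (c * _)%N bc ec => M bc ec.
(* Below cN the chunk is traversed backwards, so its element [m] comes from the label n+1-m. *)
have [i ik e] : exists2 i, (i < n)%N &
    `|f i|%N = if (M < chunk n q + m)%N then m else (n.+1 - m)%N.
  by apply: cov; case: ifP; lia.
have [i' ik' e'] := fg i ik.
have : f i = `|f i|%N%:Z \/ f i = - `|f i|%N%:Z by lia.
rewrite e; case: ifP => hlt; case=> fi.
- by exists i => //; left; rewrite fi; lia.
- by exists i' => //; right; rewrite e' fi; lia.
- by exists i' => //; right; rewrite e' fi; lia.
- by exists i => //; left; rewrite fi; lia.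
Qed.

End CyclicLayers.

(** * Base families of three, nine and five diagonals *)

Section OddBases.
Local Open Scope ring_scope.

(** On the cycle, vertex [i] lies on the edges labelled [f (prev n i)] and [f i]; edge labels and
    vertex sums must both be signed permutations. *)
Definition harmonious (n : nat) (f : nat -> int) : Prop :=
  signed_perm n f /\ signed_perm n (fun i => f i + f (prev n i)).

(* Cells (i, i-1), (i, i), (i, i+1). The label [f i] of the edge {i, i+1} is
   written in both symmetric cells, so that row i and column i have the same sum. *)
Definition tri (n : nat) (f : nat -> int) (c0 c1 c2 : int) : seq (nat -> int) :=
  [:: (fun i => f (prev n i) + c2 * (2 * n + 1)%:Z);
      (fun i => - (f i + f (prev n i)) + c0 * (2 * n + 1)%:Z);
      (fun i => f i + c1 * (2 * n + 1)%:Z)].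

Lemma tri_rowsum (n : nat) (f : nat -> int) (c0 c1 c2 : int) (i : nat) :
  c0 + c1 + c2 = 0 -> rowsum (tri n f c0 c1 c2) i = 0.
Proof.
move=> c_eq; rewrite /rowsum !big_cons big_nil.
have -> : c0 = - c1 - c2 by lia.
by ring.
Qed.

Lemma tri_colsum (n : nat) (f : nat -> int) (c0 c1 c2 : int) (j : nat) :
  c0 + c1 + c2 = 0 -> colsum n (tri n f c0 c1 c2) j = 0.
Proof.
move=> c_eq /=; have -> : c0 = - c1 - c2 by lia.
by ring.
Qed.

(** The vertex sums, with coefficient 0, fill chunk 0; the two layers of edge labels fill chunks 1
    and 2. *)
Lemma good_tri (n : nat) (f : nat -> int) :
  (0 < n)%N -> harmonious n f -> good_layers n (tri n f 0 1 (- 1)).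
Proof.
move=> n0 [fP aP]; split=> [i _|j _|q m /= q3 hm|t i /= t3 ik].
- exact: tri_rowsum.
- exact: tri_colsum.
- have [q0|q1] := posnP q.
    have [i ik e] := (signed_permN aP).2 m hm.
    by exists 1%N, i; rewrite /layer /= mul0r addr0 e q0.
  have [i ik e] := @offset_cover n 1 q m f _ (@prev_onto_of n f) fP isT
    (ltac:(lia)) hm.
  by case: e => e; [exists 2%N, i | exists 0%N, i]; split=> //=; rewrite -e /layer /=; congr absz; ring.
- have [[fb _] [ab _]] := (fP, aP).
  have := fb i ik; have := ab i ik; have := fb _ (prev_lt ik); rewrite /layer /=.
  by case: t t3 => [|[|[|//]]] _ /=; lia.
Qed.

(** Across the copies the coefficients occur in opposite pairs: 1 and -1 on the vertex sums, 2 and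
    -2, 3 and -3, 4 and -4 on edge labels. Each pair fills two chunks, and the remaining layer of
    vertex sums fills chunk 0. *)
Lemma good_tri_tri_tri (n : nat) (f : nat -> int) :
  (0 < n)%N -> harmonious n f ->
  good_layers n (tri n f 0 4 (- 4) ++ tri n f 1 2 (- 3) ++ tri n f (- 1) (- 2) 3).
Proof.
move=> n0 [fP aP]; have pP := signed_perm_prev fP; have NaP := signed_permN aP.
split=> [i _|j _|q m|t i].
- by rewrite /rowsum !big_cat /= -![bigop _ _ _]/(rowsum _ _) !tri_rowsum.
- by rewrite !colsum_cat !tri_colsum.
- move=> /= q9 hm.
  have self (h : nat -> int) i : (i < n)%N -> exists2 i', (i' < n)%N & h i' = h i by exists i.
  have [q0|q1] := posnP q.
    have [i ik e] := NaP.2 m hm.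
    by exists 1%N, i; rewrite /layer /= mul0r addr0 e q0.
  have [h|[h|[h|h]]] : (q = 2 * 1 \/ q.+1 = 2 * 1)%N \/ (q = 2 * 2 \/ q.+1 = 2 * 2)%N \/
      (q = 2 * 3 \/ q.+1 = 2 * 3)%N \/ (q = 2 * 4 \/ q.+1 = 2 * 4)%N by lia.
  + have [i ik [] e] := offset_cover (c := 1%N) (self _) NaP isT h hm.
      by exists 4%N, i; split=> //=; rewrite -e /layer /=; congr absz; ring.
    by exists 7%N, i; split=> //=; rewrite -e /layer /=; congr absz; ring.
  + have [i ik [] e] := offset_cover (c := 2%N) (self _) fP isT h hm.
      by exists 5%N, i; split=> //=; rewrite -e /layer /=; congr absz; ring.
    by exists 8%N, i; split=> //=; rewrite -e /layer /=; congr absz; ring.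
  + have [i ik [] e] := offset_cover (c := 3%N) (self _) pP isT h hm.
      by exists 6%N, i; split=> //=; rewrite -e /layer /=; congr absz; ring.
    by exists 3%N, i; split=> //=; rewrite -e /layer /=; congr absz; ring.
  + have [i ik [] e] := offset_cover (c := 4%N) (@prev_onto_of n f) fP isT h hm.
      by exists 2%N, i; split=> //=; rewrite -e /layer /=; congr absz; ring.
    by exists 0%N, i; split=> //=; rewrite -e /layer /=; congr absz; ring.
- move=> /= t9 ik; have [[fb _] [ab _]] := (fP, aP).
  have := fb i ik; have := ab i ik; have := fb _ (prev_lt ik); rewrite /layer /=.
  by case: t t9 => [|[|[|[|[|[|[|[|[|//]]]]]]]]] _ /=; lia.
Qed.

(* As for [tri], with [g i] labelling the edge {i, i+2}. *)
Definition quint (n : nat) (f g : nat -> int) : seq (nat -> int) :=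
  [:: (fun i => g (prev n (prev n i)) - 2 * (2 * n + 1)%:Z);
      (fun i => f (prev n i) - 1 * (2 * n + 1)%:Z);
      (fun i => - (f i + f (prev n i) + g i + g (prev n (prev n i))));
      (fun i => f i + 1 * (2 * n + 1)%:Z);
      (fun i => g i + 2 * (2 * n + 1)%:Z)].

Lemma good_quint (n : nat) (f g : nat -> int) :
  (0 < n)%N -> signed_perm n f -> signed_perm n g ->
  signed_perm n (fun i => f i + f (prev n i) + g i + g (prev n (prev n i))) ->
  good_layers n (quint n f g).
Proof.
move=> n0 fP gP aP; have pP := signed_perm_prev fP.
split=> [i _|j _|q m|t i].
- by rewrite /rowsum !big_cons big_nil; ring.
- by rewrite /=; ring.
- move=> /= q5 hm.
  have [q0|q1] := posnP q.
    have [i ik e] := (signed_permN aP).2 m hm.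
    by exists 2%N, i; rewrite /layer /= e q0.
  have [h|h] : (q = 2 * 1 \/ q.+1 = 2 * 1)%N \/ (q = 2 * 2 \/ q.+1 = 2 * 2)%N by lia.
  + have [i ik [] e] := offset_cover (c := 1%N) (@prev_onto_of n f) fP isT h hm.
      by exists 3%N, i; split=> //=; rewrite -e /layer /=; congr absz; ring.
    by exists 1%N, i; split=> //=; rewrite -e /layer /=; congr absz; ring.
  + have [i ik [] e] := offset_cover (c := 2%N) (@prev2_onto_of n g) gP isT h hm.
      by exists 4%N, i; split=> //=; rewrite -e /layer /=; congr absz; ring.
    by exists 0%N, i; split=> //=; rewrite -e /layer /=; congr absz; ring.
- move=> /= t5 ik; have [[fb _] [[gb _] [ab _]]] := (fP, (gP, aP)).
  have p1 := prev_lt ik; have p2 := prev_lt p1.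
  have := fb i ik; have := ab i ik; have := fb _ p1; have := gb i ik.
  have := gb _ p2; rewrite /layer /=.
  by case: t t5 => [|[|[|[|[|//]]]]] _ /=; lia.
Qed.

End OddBases.

(** * Label sequences *)

(** By counting, [n] indices that reach all of 1, ..., n leave no room for another absolute
    value. *)
Lemma signed_perm_onto (n : nat) (f : nat -> int) :
  (forall m, 0 < m <= n -> exists2 i, i < n & `|f i| = m) -> signed_perm n f.
Proof.
move=> onto; split=> // i ik.
have sub : {subset iota 1 n <= [seq `|f i| | i <- iota 0 n]}.
  move=> m; rewrite mem_iota add1n ltnS => hm; have [j jn <-] := onto m hm.
  by apply: map_f; rewrite mem_iota add0n.
have sz : size [seq `|f i| | i <- iota 0 n] <= size (iota 1 n).
  by rewrite size_map !size_iota.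
have [_ eqi] := uniq_min_size (iota_uniq 1 n) sub sz.
have : `|f i| \in iota 1 n by rewrite eqi; apply: map_f; rewrite mem_iota add0n.
by rewrite mem_iota; lia.
Qed.

Lemma prev_pos (n i : nat) : 0 < i < n -> prev n i = i.-1.
Proof. by move=> h; rewrite prevE; case: i h => [|i]; lia. Qed.

Lemma prev0 (n : nat) : 0 < n -> prev n 0 = n.-1.
Proof. by move=> h; rewrite prevE. Qed.

Ltac split_ifs := repeat (case: ifP => ?; try (exfalso; lia)).

Section Sequences.
Local Open Scope ring_scope.

(** Two zigzags with alternating signs: the neighbour sums are 2m, ..., 1 on the first and, up to
    sign, 4m+2, ..., 2m+2 on the second. The joints at 2m+1 and 0 give the missing 2m+1 and 4m+3. *)
Definition zigzag3 (m i : nat) : int :=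
  if (i < 2 * m + 1)%N then
    if (i %% 2 == 0)%N then (3 * m + 2 - i %/ 2)%N%:Z else - (m + 2 + i %/ 2)%N%:Z
  else
    if (i %% 2 == 0)%N then (i %/ 2 - m)%N%:Z else - (5 * m + 3 - i %/ 2)%N%:Z.

Lemma harmonious_zigzag3 (m : nat) : harmonious (4 * m + 3) (zigzag3 m).
Proof.
split; apply: signed_perm_onto => y hy.
  have [h1|h1] := leqP y (m + 1).
    by exists (2 * m + 2 * y)%N; [lia | rewrite /zigzag3; split_ifs; lia].
  have [h2|h2] := leqP y (2 * m + 1).
    by exists (2 * (y - m - 2) + 1)%N; [lia | rewrite /zigzag3; split_ifs; lia].
  have [h3|h3] := leqP y (3 * m + 2).
    by exists (2 * (3 * m + 2 - y))%N; [lia | rewrite /zigzag3; split_ifs; lia].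
  by exists (2 * m + 1 + 2 * (4 * m + 3 - y))%N; [lia | rewrite /zigzag3; split_ifs; lia].
have [h1|h1] := leqP y (2 * m).
  by exists (2 * m + 1 - y)%N; [lia | rewrite prev_pos /zigzag3; split_ifs; lia].
have [h2|h2] := eqVneq y (2 * m + 1)%N.
  by exists (2 * m + 1)%N; [lia | rewrite prev_pos /zigzag3; split_ifs; lia].
have [h3|h3] := eqVneq y (4 * m + 3)%N.
  by exists 0%N; [lia | rewrite prev0 /zigzag3; split_ifs; lia].
by exists (6 * m + 4 - y)%N; [lia | rewrite prev_pos /zigzag3; split_ifs; lia].
Qed.


(* The plain zigzag 2m, -(2m+1), 2m-1, ... misses the sum 2m, because its last
   edge repeats a sum; dropping the label m from it and putting m at the end
   frees 2m for the last edge. *)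
Definition pre_zigzag0 (m i : nat) : int :=
  if (i %% 2 == 1)%N then - (2 * m + 1 + i %/ 2)%N%:Z
  else if (i < 2 * m)%N then (2 * m - i %/ 2)%N%:Z
  else if (i < 4 * m - 2)%N then (2 * m - 1 - i %/ 2)%N%:Z else m%:Z.

Lemma pre_zigzag0_odd (m j : nat) :
  pre_zigzag0 m (2 * j + 1) = - (2 * m + 1 + j)%N%:Z.
Proof.
have e : ((2 * j + 1) %/ 2)%N = j by lia.
by rewrite /pre_zigzag0 e; have -> : ((2 * j + 1) %% 2 == 1)%N by lia.
Qed.

Lemma pre_zigzag0_even (m j : nat) :
  pre_zigzag0 m (2 * j) =
  (if j < m then 2 * m - j else if j < 2 * m - 1 then 2 * m - 1 - j else m)%N%:Z.
Proof.
have e : ((2 * j) %/ 2)%N = j by lia.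
have -> : (j < m)%N = (2 * j < 2 * m)%N by lia.
have -> : (j < 2 * m - 1)%N = (2 * j < 4 * m - 2)%N by lia.
rewrite /pre_zigzag0 e; have -> : ((2 * j) %% 2 == 1)%N = false by lia.
by case: ifP => // _; case: ifP.
Qed.

Lemma half_cases (i : nat) : exists j, i = (2 * j)%N \/ i = (2 * j + 1)%N.
Proof. by exists (i %/ 2)%N; lia. Qed.

Lemma pre_zigzag0_onto (m y : nat) : (1 < m)%N -> (0 < y <= 4 * m)%N ->
  exists2 i, (i < 4 * m)%N & `|pre_zigzag0 m i|%N = y.
Proof.
move=> m1 hy; have [h1|h1] := leqP (2 * m + 1) y.
  by exists (2 * (y - 2 * m - 1) + 1)%N; [lia | rewrite pre_zigzag0_odd; lia].
have [h2|h2] := leqP (m + 1) y.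
  exists (2 * (2 * m - y))%N; first lia.
  by rewrite pre_zigzag0_even; case: ifP; lia.
have [h3|h3] := leqP m y.
  exists (2 * (2 * m - 1))%N; first lia.
  by rewrite pre_zigzag0_even ltnn; case: ifP; lia.
exists (2 * (2 * m - 1 - y))%N; first lia.
rewrite pre_zigzag0_even; case: ifP; first lia.
by case: ifP; lia.
Qed.

Lemma pre_zigzag0_sum (m i : nat) : (i < 4 * m - 3)%N ->
  pre_zigzag0 m i + pre_zigzag0 m i.+1 =
  - (if (i < 2 * m - 1)%N then i.+1 else i.+2)%N%:Z.
Proof.
have [j [->|->]] := half_cases i => h.
  rewrite -{1}[(2 * j).+1]addn1 pre_zigzag0_even pre_zigzag0_odd.
  have -> : (j < 2 * m - 1)%N by lia.
  have -> : (2 * j < 2 * m - 1)%N = (j < m)%N by lia.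
  by case: ifP; lia.
have e : (2 * j + 1).+1 = (2 * j.+1)%N by lia.
rewrite {1}e pre_zigzag0_even pre_zigzag0_odd.
have -> : (j.+1 < 2 * m - 1)%N by lia.
have -> : (2 * j + 1 < 2 * m - 1)%N = (j.+1 < m)%N by lia.
by case: ifP; lia.
Qed.

(* Each distance 4m-1, 4m occurs at one side of position 3m-2, according to the
   parity of m. *)
Lemma pre_zigzag0_diff (m i : nat) : (2 * m <= i.+1)%N -> (i < 4 * m - 3)%N ->
  `|pre_zigzag0 m i.+1 - pre_zigzag0 m i|%N = (4 * m - i %% 2)%N.
Proof.
have [j [->|->]] := half_cases i => h1 h2.
  rewrite -{1}[(2 * j).+1]addn1 pre_zigzag0_even pre_zigzag0_odd.
  have -> : ((2 * j) %% 2 = 0)%N by lia.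
  by case: ifP; [lia|case: ifP; lia].
have e : (2 * j + 1).+1 = (2 * j.+1)%N by lia.
rewrite {1}e pre_zigzag0_even pre_zigzag0_odd.
have -> : ((2 * j + 1) %% 2 = 1)%N by lia.
by case: ifP; [lia|case: ifP; lia].
Qed.

(* The two edges of the last label m repeat the sums 3m-1 and 3m; one change of
   sign turns the earlier occurrences into 4m-1 and 4m. *)
Definition zigzag0 (m i : nat) : int :=
  if i == (3 * m - 2)%N then - pre_zigzag0 m i else pre_zigzag0 m i.

Lemma zigzag0E (m i : nat) : i <> (3 * m - 2)%N -> zigzag0 m i = pre_zigzag0 m i.
Proof. by rewrite /zigzag0; case: eqP. Qed.

Lemma harmonious_zigzag0 (m : nat) : (1 < m)%N -> harmonious (4 * m) (zigzag0 m).
Proof.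
move=> m1; split; apply: signed_perm_onto => y hy.
  have [i im <-] := pre_zigzag0_onto m1 hy; exists i => //.
  by rewrite /zigzag0; case: ifP; rewrite ?abszN.
have last2 : pre_zigzag0 m (4 * m - 2) = m%:Z.
  have -> : (4 * m - 2 = 2 * (2 * m - 1))%N by lia.
  rewrite pre_zigzag0_even ltnn.
  by have -> : (2 * m - 1 < m)%N = false by lia.
have last1 : pre_zigzag0 m (4 * m - 1) = - (4 * m)%N%:Z.
  have -> : (4 * m - 1 = 2 * (2 * m - 1) + 1)%N by lia.
  by rewrite pre_zigzag0_odd; lia.
have last3 : pre_zigzag0 m (4 * m - 3) = - (4 * m - 1)%N%:Z.
  have -> : (4 * m - 3 = 2 * (2 * m - 2) + 1)%N by lia.
  by rewrite pre_zigzag0_odd; lia.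
have plain i : (i < 4 * m - 3)%N -> i <> (3 * m - 2)%N -> i.+1 <> (3 * m - 2)%N ->
    (zigzag0 m i.+1 + zigzag0 m (prev (4 * m) i.+1))%R
    = - (if (i < 2 * m - 1)%N then i.+1 else i.+2)%N%:Z.
  move=> im i1 i2; rewrite prev_pos; last lia.
  by rewrite !zigzag0E // addrC pre_zigzag0_sum.
(* Ordinary edges give 1, ..., 2m-1 and 2m+1, ..., 4m-2 except 3m-1 and 3m. The closing edge gives
   2m, the two edges of the label m give 3m-1 and 3m, and the sign change gives 4m-1 and 4m. *)
have [h1|h1] := leqP y (2 * m - 1).
  case: y hy h1 => // i hy h1; exists i.+1; first lia.
  by rewrite plain; [rewrite h1 abszN|lia|lia|lia].
have [h2|h2] := eqVneq y (2 * m)%N.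
  exists 0%N; first lia.
  rewrite prev0 ?zigzag0E; [|lia..]; rewrite -subn1 last1.
  by rewrite -[0%N](muln0 2) pre_zigzag0_even; case: ifP; lia.
have [h3|h3] := eqVneq y (3 * m - 1)%N.
  exists (4 * m - 2)%N; first lia.
  rewrite prev_pos ?zigzag0E; [|lia..].
  have -> : (4 * m - 2).-1 = (4 * m - 3)%N by lia.
  by rewrite last2 last3; lia.
have [h4|h4] := eqVneq y (3 * m)%N.
  exists (4 * m - 1)%N; first lia.
  rewrite prev_pos ?zigzag0E; [|lia..].
  have -> : (4 * m - 1).-1 = (4 * m - 2)%N by lia.
  by rewrite last2 last1; lia.
have [h5|h5] := leqP y (4 * m - 2).
  exists y.-2.+1; first lia.
  rewrite plain; [|lia..].
  have -> : (y.-2 < 2 * m - 1)%N = false by lia.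
  by rewrite abszN; lia.
have diff i : (2 * m <= i.+1)%N -> (i < 4 * m - 3)%N ->
    (i = 3 * m - 2 \/ i.+1 = 3 * m - 2)%N ->
    `|(zigzag0 m i.+1 + zigzag0 m (prev (4 * m) i.+1))%R|%N = (4 * m - i %% 2)%N.
  move=> i1 i2 i3; rewrite prev_pos; last lia.
  rewrite -(pre_zigzag0_diff i1 i2) /zigzag0 [i.+1.-1]/=; case: i3 => [-> | <-].
    rewrite eqxx; have -> : ((3 * m - 2).+1 == 3 * m - 2)%N = false by lia.
    by [].
  rewrite eqxx; have -> : (i == i.+1)%N = false by lia.
  by rewrite -abszN opprD opprK.
have [h6|h6] := eqVneq ((y + m) %% 2)%N 1%N.
  exists (3 * m - 3).+1; first lia.
  by rewrite diff; lia.
exists (3 * m - 2).+1; first lia.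
by rewrite diff; lia.
Qed.

Lemma harmonious4 : harmonious 4 (nth 0 [:: 1; 3; - 4; 2]).
Proof.
split; apply: signed_perm_onto => -[|[|[|[|[|y]]]]] // _.
- by exists 0%N.
- by exists 3%N.
- by exists 1%N.
- by exists 2%N.
- by exists 2%N.
- by exists 3%N.
- by exists 0%N.
- by exists 1%N.
Qed.

Lemma harmonious_exists (n : nat) : (2 < n)%N ->
  n = 0 %[mod 4] \/ n = 3 %[mod 4] -> exists f, harmonious n f.
Proof.
move=> n2 [n0|n3].
  (* At m = 1 the sign change of [zigzag0] would produce the sum 2+3 = 5, so this case has its own
     labels. *)
  have [->|n4] := eqVneq n 4; first by eexists; apply: harmonious4.
  have -> : n = (4 * (n %/ 4))%N by lia.
  by exists (zigzag0 (n %/ 4)); apply: harmonious_zigzag0; lia.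
have -> : n = (4 * (n %/ 4) + 3)%N by lia.
by exists (zigzag3 (n %/ 4)); apply: harmonious_zigzag3.
Qed.

(* Its sums over the pairs {i, i-2} are 2, 2, -2, -2, ... up to sign, except at
   [i = 0] and [i = 1]: adding them to a run of consecutive integers permutes
   the blocks of four of that run. *)
Definition zigzag_two_step (n i : nat) : int :=
  (if (i %% 4 < 2)%N then 1 else - 1) *
  (if (i %% 2 == 0)%N then i.+1%:Z else (n - i)%N%:Z).

Lemma signed_perm_two_step (m : nat) :
  signed_perm (4 * m + 3) (zigzag_two_step (4 * m + 3)).
Proof.
apply: signed_perm_onto => y hy; have [h|h] := eqVneq (y %% 2)%N 1%N.
  by exists y.-1; [lia | rewrite /zigzag_two_step; split_ifs; lia].
by exists (4 * m + 3 - y)%N; [lia | rewrite /zigzag_two_step; split_ifs; lia].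
Qed.

(* Found by computer search: two zigzags, joined by a few exceptional labels. *)
Definition zigzag5_odd (m i : nat) : int :=
  if i == 0%N then - (m + 1)%N%:Z else if i == 1%N then (3 * m + 3)%N%:Z
  else if (i < 2 * m + 1)%N then
    if (i %% 2 == 0)%N then - (3 * m + 3 - i %/ 2)%N%:Z else (m + 2 + i %/ 2)%N%:Z
  else if i == (2 * m + 1)%N then - (2 * m + 2)%N%:Z
  else if (i < 4 * m + 2)%N then
    if (i %% 2 == 0)%N then (5 * m + 4 - i %/ 2)%N%:Z else - (i %/ 2 - m)%N%:Z
  else - (m + 2)%N%:Z.

Lemma signed_perm_zigzag5_odd (m : nat) : (m %% 2 = 1)%N ->
  signed_perm (4 * m + 3) (zigzag5_odd m).
Proof.
move=> mo; apply: signed_perm_onto => y hy.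
have [h1|h1] := leqP y m.
  by exists (2 * (y + m) + 1)%N; [lia | rewrite /zigzag5_odd; split_ifs; lia].
have [h2|h2] := eqVneq y (m + 1)%N.
  by exists 0%N; [lia | rewrite /zigzag5_odd /=; lia].
have [h3|h3] := eqVneq y (m + 2)%N.
  by exists (4 * m + 2)%N; [lia | rewrite /zigzag5_odd; split_ifs; lia].
have [h4|h4] := leqP y (2 * m + 1).
  by exists (2 * (y - m - 2) + 1)%N; [lia | rewrite /zigzag5_odd; split_ifs; lia].
have [h5|h5] := eqVneq y (2 * m + 2)%N.
  by exists (2 * m + 1)%N; [lia | rewrite /zigzag5_odd; split_ifs; lia].
have [h6|h6] := leqP y (3 * m + 2).
  by exists (2 * (3 * m + 3 - y))%N; [lia | rewrite /zigzag5_odd; split_ifs; lia].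
have [h7|h7] := eqVneq y (3 * m + 3)%N.
  by exists 1%N; [lia | rewrite /zigzag5_odd /=; lia].
by exists (2 * (5 * m + 4 - y))%N; [lia | rewrite /zigzag5_odd; split_ifs; lia].
Qed.

(** Counterpart for even [m], where 2m has the other residue modulo 4, the period of the two-step
    corrections. The exceptional labels sit at 0, 1, 2m-1 and 2m. *)
Definition zigzag5_even (m i : nat) : int :=
  if i == 0%N then (3 * m + 1)%N%:Z else if i == 1%N then - (3 * m + 2)%N%:Z
  else if (i < 2 * m - 1)%N then
    if (i %% 2 == 0)%N then (m + 1 + i %/ 2)%N%:Z else - (3 * m + 1 - i %/ 2)%N%:Z
  else if i == (2 * m - 1)%N then - (2 * m + 1)%N%:Z
  else if i == (2 * m)%N then - (2 * m + 2)%N%:Z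
  else if (i %% 2 == 0)%N then - (i %/ 2 - m)%N%:Z else (5 * m + 3 - i %/ 2)%N%:Z.

Lemma signed_perm_zigzag5_even (m : nat) : (0 < m)%N -> (m %% 2 = 0)%N ->
  signed_perm (4 * m + 3) (zigzag5_even m).
Proof.
move=> m0 me; apply: signed_perm_onto => y hy.
have [h1|h1] := leqP y (m + 1).
  by exists (2 * (y + m))%N; [lia | rewrite /zigzag5_even; split_ifs; lia].
have [h2|h2] := leqP y (2 * m).
  by exists (2 * (y - m - 1))%N; [lia | rewrite /zigzag5_even; split_ifs; lia].
have [h3|h3] := eqVneq y (2 * m + 1)%N.
  by exists (2 * m - 1)%N; [lia | rewrite /zigzag5_even; split_ifs; lia].
have [h4|h4] := eqVneq y (2 * m + 2)%N.
  by exists (2 * m)%N; [lia | rewrite /zigzag5_even; split_ifs; lia].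
have [h5|h5] := leqP y (3 * m).
  by exists (2 * (3 * m + 1 - y) + 1)%N; [lia | rewrite /zigzag5_even; split_ifs; lia].
have [h6|h6] := eqVneq y (3 * m + 1)%N.
  by exists 0%N; [lia | rewrite /zigzag5_even /=; lia].
have [h7|h7] := eqVneq y (3 * m + 2)%N.
  by exists 1%N; [lia | rewrite /zigzag5_even /=; lia].
by exists (2 * (5 * m + 3 - y) + 1)%N; [lia | rewrite /zigzag5_even; split_ifs; lia].
Qed.

End Sequences.

(** * Vertex sums for five diagonals *)

Section QuintSums.
Local Open Scope ring_scope.

Definition quint_sum (n : nat) (f g : nat -> int) (i : nat) : int :=
  f i + f (prev n i) + g i + g (prev n (prev n i)).

(** Indices two apart carry opposite signs and absolute values differing by 2. *)
Lemma two_step_sum (n i : nat) : (1 < i < n)%N ->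
  zigzag_two_step n i + zigzag_two_step n i.-2 =
  if ((i + 1) %% 4 < 2)%N then 2 else - 2.
Proof. by move=> hi; rewrite /zigzag_two_step; split_ifs; lia. Qed.

Lemma quint_sum_gt1 (n i : nat) (f : nat -> int) : (1 < i < n)%N ->
  quint_sum n f (zigzag_two_step n) i =
  f i + f i.-1 + (if ((i + 1) %% 4 < 2)%N then 2 else - 2).
Proof.
move=> hi; rewrite /quint_sum -(two_step_sum hi) (prev_pos (i := i)); last by lia.
by rewrite prev_pos ?addrA //; lia.
Qed.

(** The pair {1, n-1} wraps around, as does {0, n-2} for index 0; hence the irregular corrections -1
    and 3. *)
Lemma quint_sum1 (m : nat) (f : nat -> int) :
  quint_sum (4 * m + 3) f (zigzag_two_step (4 * m + 3)) 1 = f 1%N + f 0%N - 1.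
Proof.
rewrite /quint_sum prev_pos /=; last by lia.
rewrite prev0 /zigzag_two_step /=; last by lia.
by split_ifs; lia.
Qed.

Lemma quint_sum0 (m : nat) (f : nat -> int) :
  quint_sum (4 * m + 3) f (zigzag_two_step (4 * m + 3)) 0 =
  f 0%N + f (4 * m + 2)%N + 3.
Proof.
rewrite /quint_sum prev0; last by lia.
rewrite prev_pos /zigzag_two_step /=; last by lia.
have -> : (4 * m + 3).-1 = (4 * m + 2)%N by lia.
by split_ifs; lia.
Qed.

Lemma zigzag5_odd_run1 (m i : nat) : (2 < i <= 2 * m)%N ->
  zigzag5_odd m i + zigzag5_odd m i.-1 = i%:Z - (2 * m + 2)%N%:Z.
Proof.
move=> hi; rewrite /zigzag5_odd.
have [-> -> -> ->] : [/\ (i == 0) = false, (i == 1) = false,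
  (i.-1 == 0) = false & (i.-1 == 1) = false]%N by split; lia.
have [-> ->] : (i < 2 * m + 1)%N /\ (i.-1 < 2 * m + 1)%N by lia.
by have [e|e] := boolP (i %% 2 == 0)%N; [rewrite ifF | rewrite ifT]; lia.
Qed.

Lemma zigzag5_odd_run2 (m i : nat) : (2 * m + 2 < i < 4 * m + 2)%N ->
  zigzag5_odd m i + zigzag5_odd m i.-1 = (6 * m + 5)%N%:Z - i%:Z.
Proof.
move=> hi; rewrite /zigzag5_odd.
have [-> -> -> ->] : [/\ (i == 0) = false, (i == 1) = false,
  (i.-1 == 0) = false & (i.-1 == 1) = false]%N by split; lia.
have [-> -> -> ->] : [/\ (i < 2 * m + 1) = false, (i.-1 < 2 * m + 1) = false,
  (i == 2 * m + 1) = false & (i.-1 == 2 * m + 1) = false]%N by split; lia.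
have [-> ->] : (i < 4 * m + 2)%N /\ (i.-1 < 4 * m + 2)%N by lia.
by have [e|e] := boolP (i %% 2 == 0)%N; [rewrite ifF | rewrite ifT]; lia.
Qed.

Lemma zigzag5_even_run1 (m i : nat) : (2 < i < 2 * m - 1)%N ->
  zigzag5_even m i + zigzag5_even m i.-1 = i%:Z - (2 * m + 1)%N%:Z.
Proof.
move=> hi; rewrite /zigzag5_even.
have [-> -> -> ->] : [/\ (i == 0) = false, (i == 1) = false,
  (i.-1 == 0) = false & (i.-1 == 1) = false]%N by split; lia.
have [-> ->] : (i < 2 * m - 1)%N /\ (i.-1 < 2 * m - 1)%N by lia.
by have [e|e] := boolP (i %% 2 == 0)%N; [rewrite ifF | rewrite ifT]; lia.
Qed.

Lemma zigzag5_even_run2 (m i : nat) : (0 < m)%N -> (2 * m + 1 < i < 4 * m + 3)%N ->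
  zigzag5_even m i + zigzag5_even m i.-1 = (6 * m + 4)%N%:Z - i%:Z.
Proof.
move=> m0 hi; rewrite /zigzag5_even.
have [-> -> -> ->] : [/\ (i == 0) = false, (i == 1) = false,
  (i.-1 == 0) = false & (i.-1 == 1) = false]%N by split; lia.
have [-> -> -> ->] : [/\ (i < 2 * m - 1) = false, (i.-1 < 2 * m - 1) = false,
  (i == 2 * m - 1) = false & (i.-1 == 2 * m - 1) = false]%N by split; lia.
have [-> ->] : (i == 2 * m)%N = false /\ (i.-1 == 2 * m)%N = false by lia.
by have [e|e] := boolP (i %% 2 == 0)%N; [rewrite ifF | rewrite ifT]; lia.
Qed.

Lemma signed_perm_quint_odd (m : nat) : (m %% 2 = 1)%N ->
  signed_perm (4 * m + 3)
    (quint_sum (4 * m + 3) (zigzag5_odd m) (zigzag_two_step (4 * m + 3))).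
Proof.
move=> mo; apply: signed_perm_onto => y hy.
have [h|h] := eqVneq y 1%N.
  by exists 2%N; [lia | rewrite quint_sum_gt1 /zigzag5_odd /=; split_ifs; lia].
have [h1|h1] := leqP y (2 * m - 1).
  (* On the first run the absolute sums are [2 * m + 2 - i] moved down or up by 2. As 2m is 2 modulo
     4, the residue of [y] tells which. *)
  have [e|e] := boolP ((y %% 4 == 2) || (y %% 4 == 3))%N.
    by exists (2 * m - y)%N; [lia | rewrite quint_sum_gt1 ?zigzag5_odd_run1; split_ifs; lia].
  by exists (2 * m + 4 - y)%N; [lia | rewrite quint_sum_gt1 ?zigzag5_odd_run1; split_ifs; lia].
have [h2|h2] := eqVneq y (2 * m)%N.
  by exists 0%N; [lia | rewrite quint_sum0 /zigzag5_odd /=; split_ifs; lia].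
have [h3|h3] := eqVneq y (2 * m + 1)%N.
  by exists 1%N; [lia | rewrite quint_sum1 /zigzag5_odd /=; lia].
have [h4|h4] := eqVneq y (2 * m + 2)%N.
  by exists (4 * m + 1)%N; [lia | rewrite quint_sum_gt1 ?zigzag5_odd_run2; split_ifs; lia].
have [h5|h5] := eqVneq y (2 * m + 3)%N.
  by exists (2 * m + 2)%N; [lia | rewrite quint_sum_gt1 /zigzag5_odd; split_ifs; lia].
have [h6|h6] := eqVneq y (2 * m + 4)%N.
  by exists (4 * m + 2)%N; [lia | rewrite quint_sum_gt1 /zigzag5_odd; split_ifs; lia].
have [h7|h7] := eqVneq y (4 * m + 3)%N.
  by exists (2 * m + 1)%N; [lia | rewrite quint_sum_gt1 /zigzag5_odd; split_ifs; lia].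
have [e|e] := boolP ((y %% 4 == 0) || (y %% 4 == 3))%N.
  by exists (6 * m + 3 - y)%N; [lia | rewrite quint_sum_gt1 ?zigzag5_odd_run2; split_ifs; lia].
by exists (6 * m + 7 - y)%N; [lia | rewrite quint_sum_gt1 ?zigzag5_odd_run2; split_ifs; lia].
Qed.

Lemma signed_perm_quint_even (m : nat) : (0 < m)%N -> (m %% 2 = 0)%N ->
  signed_perm (4 * m + 3)
    (quint_sum (4 * m + 3) (zigzag5_even m) (zigzag_two_step (4 * m + 3))).
Proof.
move=> m0 me; apply: signed_perm_onto => y hy.
have [h|h] := eqVneq y 1%N.
  by exists (2 * m - 1)%N; [lia | rewrite quint_sum_gt1 /zigzag5_even; split_ifs; lia].
have [h0|h0] := eqVneq y 2%N.
  by exists 1%N; [lia | rewrite quint_sum1 /zigzag5_even /=; lia].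
have [h1|h1] := leqP y (2 * m - 2).
  have [e|e] := boolP ((y %% 4 == 0) || (y %% 4 == 3))%N.
    by exists (2 * m - 1 - y)%N; [lia | rewrite quint_sum_gt1 ?zigzag5_even_run1; split_ifs; lia].
  by exists (2 * m + 3 - y)%N; [lia | rewrite quint_sum_gt1 ?zigzag5_even_run1; split_ifs; lia].
have [h2|h2] := eqVneq y (2 * m - 1)%N.
  by exists (2 * m + 1)%N; [lia | rewrite quint_sum_gt1 /zigzag5_even; split_ifs; lia].
have [h3|h3] := eqVneq y (2 * m + 2)%N.
  by exists 2%N; [lia | rewrite quint_sum_gt1 /zigzag5_even /=; split_ifs; lia].
have [h4|h4] := eqVneq y (2 * m + 3)%N.
  by exists 0%N; [lia | rewrite quint_sum0 /zigzag5_even /=; split_ifs; lia].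
have [h5|h5] := eqVneq y (4 * m + 1)%N.
  by exists (2 * m)%N; [lia | rewrite quint_sum_gt1 /zigzag5_even; split_ifs; lia].
have [e|e] := boolP ((y %% 4 == 2) || (y %% 4 == 3))%N.
  by exists (6 * m + 6 - y)%N; [lia | rewrite quint_sum_gt1 ?zigzag5_even_run2; split_ifs; lia].
by exists (6 * m + 2 - y)%N; [lia | rewrite quint_sum_gt1 ?zigzag5_even_run2; split_ifs; lia].
Qed.

Lemma Heffter5 (n : nat) : (5 <= n)%N -> n = 3 %[mod 4] ->
  exists_integer_Heffter n 5 5.
Proof.
move=> n5 n3; have -> : n = (4 * (n %/ 4) + 3)%N by lia.
move: (n %/ 4)%N (ltac:(lia) : (0 < n %/ 4)%N) => m m0 {n n5 n3}.
have gP := signed_perm_two_step m.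
have [me|mo] := eqVneq (m %% 2)%N 0%N.
  apply: (Heffter_of_good_layers (s := quint _ _ _)); first by rewrite /=; lia.
  apply: (good_quint _ (signed_perm_zigzag5_even m0 me) gP); first by lia.
  exact: signed_perm_quint_even.
apply: (Heffter_of_good_layers (s := quint _ _ _)); first by rewrite /=; lia.
have {}mo : (m %% 2 = 1)%N by lia.
apply: (good_quint _ (signed_perm_zigzag5_odd mo) gP); first by lia.
exact: signed_perm_quint_odd.
Qed.

End QuintSums.

(** * Two by two blocks *)

Section BlockLayers.
Local Open Scope ring_scope.

Variable h : nat.
Hypothesis h3 : (2 < h)%N.

Local Notation N := (4 * h + 1)%N.

(* The cell in row [i] of layer [t] lies in the block row [i / 2] and in the
   block diagonal [t / 2]; the parities of its row and column are [i % 2] and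
   [(t + i) % 2]. *)
Definition block_col (t i : nat) : nat :=
  (2 * ((i %/ 2 + t %/ 2) %% h) + (t + i) %% 2)%N.

Definition block_row (t j : nat) : nat :=
  (2 * ((j %/ 2 + t %/ 2 * h.-1) %% h) + (t + j) %% 2)%N.

(** The signs are +, +, -, +, -, and so on. The first three diagonals balance by 2+2-4 (or -5+6-1)
    and 1+1-2; later ones, with the default steps of [nth], cancel in pairs. *)
Definition block_sign (e : nat) : int := if (e == 0%N) || odd e then 1 else - 1.

(* An ordinary block of diagonal 0 or 1 fills four consecutive integers, but those
   of diagonal 2 only fill intervals of eight, in pairs. So for odd [h] one block
   row is special: in diagonal 0 it has {1, 2, 3, 4} as the values -1, 4, -2, 3 of
   a, a-r, a-c, a-r-c, in diagonal 1 it has {4h-7, 4h-6, 4h-1, 4h}, around an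
   ordinary block, and in diagonal 2 four consecutive integers. *)
Definition row_step (e I : nat) : int :=
  if odd h && (I == h.-1) then nth 2 [:: - 5; 6; 1] e else nth 2 [:: 2; 2; 4] e.

Definition col_step (e : nat) : int := nth 1 [:: 1; 1; 2] e.

(** With steps 2 and 1 a block fills the four integers ending at its base; with steps 4 and 2,
    blocks 2J and 2J+1 interleave to fill eight. For odd [h], block h-2 of diagonal 0 takes the last
    four numbers above N, which the special block of diagonal 1 leaves free. *)
Definition block_base (e I : nat) : int :=
  if e == 0%N then
    if ~~ odd h then (4 + 4 * I)%N%:Z
    else if (I < h - 3)%N then (8 + 4 * I)%N%:Z
    else if I == (h - 3)%N then (4 * h - 2)%N%:Z
    else if I == (h - 2)%N then (N + 4 * h)%N%:Z else - 1
  else if e == 1%N then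
    if odd h && (I == h.-1) then (4 * h)%N%:Z else (N + 4 + 4 * I)%N%:Z
  else if e == 2%N then
    if odd h && (I == h.-1) then (2 * N + 4 * h)%N%:Z
    else (2 * N + 8 * (I %/ 2) + 7 + I %% 2)%N%:Z
  else (e * N + 4 * I + 4)%N%:Z.

Definition block_entry (e I p q : nat) : int :=
  block_base e I - row_step e I * q%:Z - col_step e * p%:Z.

(** Even layers hold the main diagonals of the blocks and odd layers the antidiagonals, which get
    the minus signs. *)
Definition block_val (t i : nat) : int :=
  (- 1) ^+ odd t * block_sign (t %/ 2) *
  block_entry (t %/ 2) (i %/ 2) (i %% 2) ((t + i) %% 2).

Lemma sum_double (E : nat) (w : nat -> int) :
  \sum_(t < (2 * E)%N) w t = \sum_(e < E) (w (2 * e)%N + w (2 * e).+1).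
Proof.
elim: E => [|E IH]; first by rewrite muln0 !big_ord0.
by rewrite mulnS !big_ord_recr /= -IH addrA.
Qed.

Lemma block_sign_sum (b : nat) (c : nat -> int) : 
  c 0%N + c 1%N - c 2 = 0 -> (forall e, c e.+3 = c 3) ->
  \sum_(e < (2 * b + 3)%N) block_sign e * c e = 0.
Proof.
move=> c0 c3; elim: b => [|b IH].
  by rewrite !big_ord_recr big_ord0 /= /block_sign /= add0r !mul1r mulN1r.
have -> : (2 * b.+1 + 3 = (2 * b + 3).+2)%N by lia.
rewrite !big_ord_recr /= IH /block_sign.
have -> : ((2 * b + 3 == 0) = false)%N by lia.
have -> : (((2 * b + 3).+1 == 0) = false)%N by lia.
have -> : odd (2 * b + 3) by lia.
have -> : odd (2 * b + 3).+1 = false by lia.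
have -> : (2 * b + 3 = (2 * b).+3)%N by lia.
by rewrite -[(2 * b).+4]/((2 * b).+1.+3) !c3 /=; lia.
Qed.

Lemma block_rowsum (b i : nat) : (i < 2 * h)%N ->
  \sum_(t < (2 * (2 * b + 3))%N) block_val t i = 0.
Proof.
move=> ih; rewrite (sum_double _ (block_val^~ i)).
have E e : block_val (2 * e) i + block_val (2 * e).+1 i =
   (if (i %% 2 == 0)%N then 1 else - 1) * (block_sign e * row_step e (i %/ 2)).
  rewrite /block_val.
  have [-> -> -> ->] : [/\ (2 * e) %/ 2 = e, (2 * e).+1 %/ 2 = e, odd (2 * e) = false
    & odd (2 * e).+1 = true]%N by split; lia.
  rewrite /block_entry; have [e1|e1] := boolP (i %% 2 == 0)%N.
    have -> : ((2 * e + i) %% 2 = 0)%N by lia.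
    have -> : (((2 * e).+1 + i) %% 2 = 1)%N by lia.
    by rewrite /=; ring.
  have -> : ((2 * e + i) %% 2 = 1)%N by lia.
  have -> : (((2 * e).+1 + i) %% 2 = 0)%N by lia.
  by rewrite /=; ring.
under eq_bigr do rewrite E.
rewrite -mulr_sumr (@block_sign_sum b (row_step^~ (i %/ 2)%N)) ?mulr0 //.
  by rewrite /row_step; case: ifP.
by move=> e; rewrite /row_step /= !nth_nil.
Qed.

(** A block column meets the diagonals in different block rows, so it matters that [col_step]
    depends on the diagonal alone. *)
Lemma block_colsum (b j : nat) : (j < 2 * h)%N ->
  \sum_(t < (2 * (2 * b + 3))%N) block_val t (block_row t j) = 0.
Proof.
move=> jh; rewrite (sum_double _ (fun t => block_val t (block_row t j))).
have E e : block_val (2 * e) (block_row (2 * e) j) +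
           block_val (2 * e).+1 (block_row (2 * e).+1 j) =
   (if (j %% 2 == 0)%N then 1 else - 1) * (block_sign e * col_step e).
  rewrite /block_val /block_row.
  have [-> -> -> ->] : [/\ (2 * e) %/ 2 = e, (2 * e).+1 %/ 2 = e, odd (2 * e) = false
    & odd (2 * e).+1 = true]%N by split; lia.
  move: (_ %% h)%N => I; rewrite /block_entry.
  have [-> -> -> ->] : [/\ (2 * I + (2 * e + j) %% 2) %/ 2 = I,
    (2 * I + ((2 * e).+1 + j) %% 2) %/ 2 = I,
    (2 * I + (2 * e + j) %% 2) %% 2 = j %% 2 &
    (2 * I + ((2 * e).+1 + j) %% 2) %% 2 = j.+1 %% 2]%N by split; lia.
  have -> : ((2 * e + (2 * I + (2 * e + j) %% 2)) %% 2 = j %% 2)%N by lia.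
  have -> : (((2 * e).+1 + (2 * I + ((2 * e).+1 + j) %% 2)) %% 2 = j %% 2)%N by lia.
  have [e1|e1] := boolP (j %% 2 == 0)%N.
    have [-> ->] : (j %% 2 = 0 /\ j.+1 %% 2 = 1)%N by lia.
    by rewrite /=; ring.
  have [-> ->] : (j %% 2 = 1 /\ j.+1 %% 2 = 0)%N by lia.
  by rewrite /=; ring.
under eq_bigr do rewrite E.
rewrite -mulr_sumr (@block_sign_sum b col_step) ?mulr0 //.
by move=> e; rewrite /col_step /= !nth_nil.
Qed.

Lemma abs_block_val (t i : nat) :
  `|block_val t i|%N = `|block_entry (t %/ 2) (i %/ 2) (i %% 2) ((t + i) %% 2)|%N.
Proof.
by rewrite /block_val /block_sign; case: (odd t); case: ifP => _ /=; lia.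
Qed.

Lemma block_entry_cover (k x : nat) : (5 < k)%N ->
  (0 < x)%N -> (2 * x <= k * N)%N -> ~~ odd k -> ~~ (N %| x)%N ->
  exists e I p q, [/\ [/\ (2 * e < k)%N, (I < h)%N, (p < 2)%N & (q < 2)%N] &
    `|block_entry e I p q|%N = x].
Proof.
move=> k6 x0 xk ke; rewrite /dvdn => xN.
have r2 : (x %% N < N)%N by rewrite ltn_mod addn1.
have xE := divn_eq x N; move: xE r2 xN.
move: (x %/ N)%N (x %% N)%N => e r xE r2 xN.
have ek : (2 * e < k)%N by nia.
have c4 := ltn_pmod (r - 1) (isT : (0 < 4)%N).
have witness e' I p q : [/\ (2 * e' < k)%N, (I < h)%N, (p < 2)%N & (q < 2)%N] ->
    block_base e' I - row_step e' I * q%:Z - col_step e' * p%:Z = x%:Z \/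
    block_base e' I - row_step e' I * q%:Z - col_step e' * p%:Z = - x%:Z ->
    exists e I p q, [/\ [/\ (2 * e < k)%N, (I < h)%N, (p < 2)%N & (q < 2)%N] &
      `|block_entry e I p q|%N = x].
  by move=> bnd ent; exists e', I, p, q; split=> //; rewrite /block_entry; case: ent => ->; lia.
clear xk.
case: e xE ek => [|[|[|e]]] xE ek.
- rewrite add0n in xE; subst r.
  have [hodd|heven] := boolP (odd h); last first.
    (* The distance from [x] up to the base of its block is 2q+p, so [q] and [p] are its binary
       digits. *)
    apply: (witness 0%N ((x - 1) %/ 4)%N ((3 - (x - 1) %% 4) %% 2)%N
      ((3 - (x - 1) %% 4) %/ 2)%N); first by split; lia.
    by left; rewrite /block_base /row_step /col_step heven (negPf heven) /=; lia.
  have spec : [/\ block_base 0 h.-1 = - 1, row_step 0 h.-1 = - 5,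
      block_base 1 h.-1 = (4 * h)%N%:Z & row_step 1 h.-1 = 6].
    rewrite /block_base /row_step hodd /=.
    have -> : (h.-1 < h - 3)%N = false by lia.
    have -> : (h.-1 == h - 3)%N = false by lia.
    have -> : (h.-1 == h - 2)%N = false by lia.
    by rewrite eqxx.
  case: spec => b0 s0 b1 s1.
  have [x4|x4] := leqP x 4.
    apply: (witness 0%N h.-1 ((x == 2) || (x == 3))%N ((x == 3) || (x == 4))%N).
      by split; lia.
    rewrite b0 s0 /col_step /=.
    by case: x x4 x0 {witness xN r2 c4} => [|[|[|[|[|x]]]]] //= _ _; tauto.
  have bulk I : (I < h - 2)%N -> row_step 0 I = 2.
    by move=> hI; rewrite /row_step hodd ifF //=; lia.
  have [x8|x8] := leqP x (4 * h - 8).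
    apply: (witness 0%N ((x - 5) %/ 4)%N ((3 - (x - 1) %% 4) %% 2)%N
      ((3 - (x - 1) %% 4) %/ 2)%N); first by split; lia.
    left; rewrite bulk //; last by lia.
    by rewrite /block_base /col_step hodd /= ifT; lia.
  have [xs|xs] := boolP ((x == 4 * h - 7) || (x == 4 * h - 6) || (x == 4 * h - 1) || (x == 4 * h))%N.
    apply: (witness 1%N h.-1 ((x == 4 * h - 7) || (x == 4 * h - 1))%N
      ((x == 4 * h - 7) || (x == 4 * h - 6))%N); first by split; lia.
    by left; rewrite b1 s1 /col_step /=; lia.
  apply: (witness 0%N (h - 3)%N ((4 * h - 2 - x) %% 2)%N ((4 * h - 2 - x) %/ 2)%N).
    by split; lia.
  left; rewrite bulk //; last by lia.
  by rewrite /block_base /col_step hodd /= ltnn eqxx; lia.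
- have [hodd|heven] := boolP (odd h); last first.
    apply: (witness 1%N ((r - 1) %/ 4)%N ((3 - (r - 1) %% 4) %% 2)%N
      ((3 - (r - 1) %% 4) %/ 2)%N); first by split; lia.
    by left; rewrite /block_base /row_step /col_step (negPf heven) /=; lia.
  have [xs|xs] := leqP r (4 * h - 4).
    apply: (witness 1%N ((r - 1) %/ 4)%N ((3 - (r - 1) %% 4) %% 2)%N
      ((3 - (r - 1) %% 4) %/ 2)%N); first by split; lia.
    have hI : ((r - 1) %/ 4 == h.-1)%N = false by lia.
    by left; rewrite /block_base /row_step /col_step hI andbF /=; lia.
  (* These last four residues above N belong to diagonal 0, not to diagonal 1. *)
  apply: (witness 0%N (h - 2)%N ((4 * h - r) %% 2)%N ((4 * h - r) %/ 2)%N).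
    by split; lia.
  left; rewrite /block_base /row_step /col_step hodd /=.
  have -> : (h - 2 < h - 3)%N = false by lia.
  have -> : (h - 2 == h - 3)%N = false by lia.
  have -> : (h - 2 == h.-1)%N = false by lia.
  by rewrite eqxx /=; lia.
- have [hs|hs] := boolP (odd h && (4 * h - 3 <= r)%N).
    case/andP: hs => hodd hr.
    apply: (witness 2%N h.-1 ((4 * h - r) %/ 2)%N ((4 * h - r) %% 2)%N).
      by split; lia.
    by left; rewrite /block_base /row_step /col_step hodd eqxx /=; lia.
  have hI : odd h && ((2 * ((r - 1) %/ 8) + (r - 1) %% 2) == h.-1)%N = false.
    by apply/negP => /andP[ho /eqP hI]; move: hs; rewrite ho /=; lia.
  (* In an interval of eight, the low bit of r-1 selects one of the two interleaved blocks and the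
     other two bits select the cell. *)
  apply: (witness 2%N (2 * ((r - 1) %/ 8) + (r - 1) %% 2)%N
    ((3 - (r - 1) %% 8 %/ 2) %% 2)%N ((3 - (r - 1) %% 8 %/ 2) %/ 2)%N).
    by split; lia.
  left; rewrite /block_base /row_step /col_step hI /=.
  have -> : ((2 * ((r - 1) %/ 8) + (r - 1) %% 2) %/ 2 = (r - 1) %/ 8)%N by lia.
  have -> : ((2 * ((r - 1) %/ 8) + (r - 1) %% 2) %% 2 = (r - 1) %% 2)%N by lia.
  by lia.
- apply: (witness e.+3 ((r - 1) %/ 4)%N ((3 - (r - 1) %% 4) %% 2)%N
    ((3 - (r - 1) %% 4) %/ 2)%N); first by split; lia.
  left; rewrite /block_base /row_step /col_step /= !nth_nil if_same.
  by move: (e.+3 * N)%N xE => M xE; lia.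
Qed.

Lemma block_entry_bound (k e I p q : nat) : (5 < k)%N -> ~~ odd k ->
  (2 * e < k)%N -> (I < h)%N -> (p < 2)%N -> (q < 2)%N ->
  (2 * `|block_entry e I p q| < k * N)%N.
Proof.
move=> k6 ke ek Ih p2 q2.
(* Diagonal 0 may exceed N, hence the maximum with 2; three multiples of N are available because [k]
   is at least 6. *)
suff lt_e : (`|block_entry e I p q| < (maxn e 2).+1 * N)%N.
  apply: (@leq_trans (2 * ((maxn e 2).+1 * N))%N).
    by rewrite ltn_mul2l.
  by rewrite mulnA leq_mul2r; apply/orP; right; lia.
rewrite /block_entry /block_base /row_step /col_step.
case: e ek => [|[|[|e]]] ek /=.
- by split_ifs; lia.
- by split_ifs; lia.
- by split_ifs; lia.
- rewrite !nth_nil if_same (maxn_idPl _) // [(e.+4 * N)%N]mulSn.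
  by move: (e.+3 * N)%N => M; lia.
Qed.

Lemma Heffter_2mod4 (k : nat) : (5 < k <= 2 * h)%N -> k = 2 %[mod 4] ->
  exists_integer_Heffter (2 * h) k k.
Proof.
move=> kh k2; have NE : (2 * (2 * h) + 1 = N)%N by lia.
have h0 : (0 < h)%N by lia.
have kE : k = (2 * (2 * ((k - 6) %/ 4) + 3))%N by lia.
have halfK x y : (y < 2)%N -> ((2 * x + y) %/ 2 = x)%N by lia.
have shift e : (e + e * h.-1 = e * h)%N by rewrite -mulnS prednK.
have colK a e : (a < h)%N -> (((a + e) %% h + e * h.-1) %% h = a)%N.
  by move=> ah; rewrite modnDml -addnA shift addnC modnMDl modn_small.
have rowK a e : (a < h)%N -> (((a + e * h.-1) %% h + e) %% h = a)%N.
  by move=> ah; rewrite modnDml -addnA [(_ * _ + _)%N]addnC shift addnC modnMDl modn_small.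
have col2 t i : (block_col t i %/ 2 = (i %/ 2 + t %/ 2) %% h)%N by rewrite halfK ?ltn_mod.
have row2 t j : (block_row t j %/ 2 = (j %/ 2 + t %/ 2 * h.-1) %% h)%N.
  by rewrite halfK ?ltn_mod.
have colM t i : (block_col t i %% 2 = (t + i) %% 2)%N by rewrite /block_col; lia.
have rowM t i : (block_row t i %% 2 = (t + i) %% 2)%N by rewrite /block_row; lia.
apply: (@Heffter_of_layers _ _ block_val block_col block_row); rewrite ?NE; try lia.
- move=> t i tk ik; split.
    by rewrite /block_col; have := ltn_pmod (i %/ 2 + t %/ 2)%N h0; lia.
  have := colM t i; rewrite /block_row col2 colK; last by lia.
  by move: (block_col t i); lia.
- move=> t j tk jk; split.
    by rewrite /block_row; have := ltn_pmod (j %/ 2 + t %/ 2 * h.-1)%N h0; lia.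
  have := rowM t j; rewrite /block_col row2 rowK; last by lia.
  by move: (block_row t j); lia.
- move=> t t' i tk tk' ik; rewrite /block_col => e.
  have e1 : ((i %/ 2 + t %/ 2) %% h = (i %/ 2 + t' %/ 2) %% h)%N by lia.
  have e2 : ((t + i) %% 2 = (t' + i) %% 2)%N by lia.
  move/eqP: e1; rewrite eqn_modDl !modn_small; [|lia|lia].
  by move/eqP; lia.
- by move=> i ik; rewrite kE block_rowsum.
- by move=> j jk; rewrite kE block_colsum.
- by move=> t i tk ik; rewrite abs_block_val; apply: block_entry_bound; lia.
- move=> x x0 xk xN.
  have [||e [I [p [q [[ek Ih p2 q2] <-]]]]] := @block_entry_cover k x _ x0 xk _ xN; try lia.
  (* The cell is on the main diagonal of its block exactly when [p] and [q] agree. *)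
  exists (2 * e + (p + q) %% 2)%N, (2 * I + p)%N; split; try lia.
  by rewrite abs_block_val; congr (`|block_entry _ _ _ _|%N); lia.
Qed.

End BlockLayers.

(** * The theorem *)

Lemma Heffter_exists (n k : nat) : 3 <= k <= n -> k <> 5 ->
  [\/ odd k /\ (n = 0 %[mod 4] \/ n = 3 %[mod 4]),
      k = 2 %[mod 4] /\ ~~ odd n
    | k = 0 %[mod 4]] -> exists_integer_Heffter n k k.
Proof.
move=> kn k5 [[ko n03]|[k2 ne]|k0].
- have [f fP] := harmonious_exists (ltac:(lia) : 2 < n) n03.
  have n0 : 0 < n by lia.
  (* In the class of 1 modulo 4, excluding 5 leaves [k] at least 9, the size of the threefold
     base. *)
  have [k1|k3] := eqVneq (k %% 4) 1.
    by apply: (Heffter_mod4 _ (good_tri_tri_tri n0 fP)); rewrite /=; lia.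
  by apply: (Heffter_mod4 _ (good_tri n0 fP)); rewrite /=; lia.
- have -> : n = 2 * (n %/ 2) by lia.
  by apply: Heffter_2mod4; lia.
- by apply: (Heffter_mod4 _ (good_nil n)); rewrite /=; lia.
Qed.

Lemma Heffter_parity (n k : nat) : 0 < n -> 0 < k -> exists_integer_Heffter n k k ->
  [\/ odd k /\ (n = 0 %[mod 4] \/ n = 3 %[mod 4]),
      k = 2 %[mod 4] /\ ~~ odd n
    | k = 0 %[mod 4]].
Proof.
move=> n0 k0 /(integer_Heffter_even_sum n0 k0); rewrite odd_support_sum.
have [ko|ke] := boolP (odd k).
  move=> hC; apply: Or31; split=> //.
  have : 'C(n.+1, 2) * 2 = n.+1 * n 
    by rewrite bin2 -divn2 divnK // dvdn2 oddM /=; case: (odd n).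
  move: ('C(n.+1, 2)) hC => C hC.
  rewrite {1 2}(divn_eq n 4); move: (n %/ 4) => m hm.
  suff : n %% 4 <> 1 /\ n %% 4 <> 2 by lia.
  (* In both excluded classes the triangular number is odd; the expressions below display it as
     twice an integer plus 1. *)
  split=> r; rewrite r in hm.
    have : C = 2 * (m * (4 * m + 3)) + 1 by nia.
    by move: (m * _) => z; lia.
  have : C = 2 * (m * (4 * m + 5) + 1) + 1 by nia.
  by move: (m * _) => z; lia.
have [no|ne] := boolP (odd n) => hk; first by apply: Or33; lia.
have [k2|k4] : k %% 4 = 2 \/ k %% 4 = 0 by lia.
  by apply: Or32; split=> //; lia.
by apply: Or33.
Qed.

Theorem theorem1p5 :
  (forall n k : nat, 3 <= k <= n -> k <> 5 ->
     (exists_integer_Heffter n k k <->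
      [\/ odd k /\ (n = 0 %[mod 4] \/ n = 3 %[mod 4]),
          k = 2 %[mod 4] /\ ~~ odd n
        | k = 0 %[mod 4]]))
  /\
  (forall n : nat, 5 <= n ->
     (n = 3 %[mod 4] -> exists_integer_Heffter n 5 5) /\
     (n = 1 %[mod 4] \/ n = 2 %[mod 4] -> ~ exists_integer_Heffter n 5 5)).
Proof.
split=> [n k kn k5|n n5].
  split; last exact: Heffter_exists.
  by apply: Heffter_parity; lia.
split; first exact: Heffter5.
move=> n12 /Heffter_parity.
by case/(_ (ltac:(lia)) isT) => [[_ n03]|[]|] //; lia.
Qed.
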